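(* Let $\mathcal{M}=(G,In,Out,L)$ be a linear compartmental model with $L=In\cup Out$, and assume that $G$ is output connectable and $|Out|=1$. Let $\widetilde{\mathcal{M}}=(G,In,Out,V)$ be the corresponding model with a leak in every compartment. Then $\mathcal{M}$ is locally identifiable if and only if the image of the coefficient map of $\widetilde{\mathcal{M}}$ has dimension $|E|+|In\cup Out|$.
   Context: A linear compartmental model $(G,In,Out,Leak)$ consists of a finite directed graph $G=(V,E)$ (no self-loops, no repeated edges) and subsets $In,Out,Leak\subseteq V$ (input, output and leak compartments; $In,Out$ nonempty). Each edge $j\to i$ carries an independent parameter $a_{ij}$ and each $i\in Leak$ an independent parameter $a_{0i}$. The compartmental matrix $A$ has $A_{ij}=a_{ij}$ if $j\to i\in E$; $A_{ii}=-a_{0i}-\sum_{k:\,i\to k\in E}a_{ki}$ if $i\in Leak$; $A_{ii}=-\sum_{k:\,i\to k\in E}a_{ki}$ if $i\notin Leak$; all other entries $0$. The model is the system $x'=Ax+u$, $y_i=x_i$ for $i\in Out$, with $u_i\equiv 0$ for $i\notin In$. The model is output connectable if every vertex has a directed path leading from it to an output vertex. When $Out=\{j\}$ and the model is output connectable, the input-output equation is $\det(\partial I-A)\,y_j=\sum_{i\in In}(-1)^{i+j}\det(\partial I-A)_{ij}\,u_i$, where $\partial=d/dt$ and $(\cdot)_{ij}$ means delete row $i$ and column $j$. The coefficient map $c:\mathbb{R}^{|E|+|Leak|}\to\mathbb{R}^k$ collects all nonzero, nonmonic coefficients (polynomials in the parameters) of this equation. A model is (generically) locally identifiable if, outside a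 set of measure zero in parameter space, every point has a neighborhood on which $c$ is one-to-one; equivalently, the Jacobian of $c$ has rank $|E|+|Leak|$ at a generic point. *)

(* Defs.v *)
(* mpoly must come before the analysis files, whose notations then take
   precedence. *)
From HB Require Import structures.
From mathcomp Require Import all_boot all_order all_algebra.
From mathcomp Require Import mpoly.
From mathcomp Require Import boolp classical_sets reals topology normedtype.

Set Implicit Arguments.
Unset Strict Implicit.
Unset Printing Implicit Defensive.

Import Order.TTheory GRing.Theory Num.Theory.
Import numFieldNormedType.Exports.

Local Open Scope classical_set_scope.
Local Open Scope ring_scope.

(* (j, i) \in edges means that there is an edge j -> i. *)
Record model (n : nat) := Model {
  edges : {set 'I_n * 'I_n};
  input : {set 'I_n};
  output : {set 'I_n};
  leak : {set 'I_n};
  edges_irrefl : forall i, (i, i) \notin edges;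
  input_neq0 : input != finset.set0;
  output_neq0 : output != finset.set0
}.

Definition leak_everywhere (n : nat) (M : model n) : model n :=
  Model [set: 'I_n]%SET (edges_irrefl M) (input_neq0 M) (output_neq0 M).

Definition output_connectable (n : nat) (M : model n) : Prop :=
  forall v : 'I_n, exists2 w : 'I_n,
    w \in output M & connect [rel x y | (x, y) \in edges M] v w.

(* The index set of the parameters: a_{ij} for an edge j -> i, and a_{0i} for a
   leak compartment i. *)
Definition param (n : nat) (M : model n) : finType :=
  ({e : 'I_n * 'I_n | e \in edges M} + {i : 'I_n | i \in leak M})%type.

Definition nparam (n : nat) (M : model n) : nat := #|param M|.

Lemma nparamE (n : nat) (M : model n) :
  nparam M = (#|edges M| + #|leak M|)%N.
Proof. by rewrite /nparam card_sum !card_sig. Qed.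

Section Coefficients.
Variables (R : realType) (n : nat) (M : model n).

Definition param_var (p : param M) : {mpoly R[nparam M]} := 'X_(enum_rank p).

(* The label a_{ij} of the edge j -> i; it is 0 when there is no such edge. *)
Definition edge_param (i j : 'I_n) : {mpoly R[nparam M]} :=
  oapp (fun e => param_var (inl e)) 0 (insub (j, i)).

(* The leak parameter a_{0i}; it is 0 when i is not a leak compartment. *)
Definition leak_param (i : 'I_n) : {mpoly R[nparam M]} :=
  oapp (fun l => param_var (inr l)) 0 (insub i).

Definition compartmental_mx : 'M[{mpoly R[nparam M]}]_n :=
  \matrix_(i, j) if i == j
                 then - leak_param i - \sum_(k | (i, k) \in edges M) edge_param k i
                 else edge_param i j.

(* The two sides of the input-output equation for y_j, as polynomials in the
   differential operator d/dt: char_poly A is det('X - A), and cofactor B i j is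
   (-1)^(i+j) times the determinant of B with row i and column j deleted. *)
Definition io_lhs : {poly {mpoly R[nparam M]}} := char_poly compartmental_mx.

Definition io_rhs (j i : 'I_n) : {poly {mpoly R[nparam M]}} :=
  cofactor (char_poly_mx compartmental_mx) i j.

(* The only nonzero constant coefficients are the leading 1 of io_lhs and, when
   j is an input, the leading 1 of io_rhs j j; these are the monic ones. *)
Definition io_coefs (j : 'I_n) : seq {mpoly R[nparam M]} :=
  [seq p <- (io_lhs : seq _)
            ++ flatten [seq (io_rhs j i : seq _) | i <- enum (input M)]
     | (p != 0) && (p != 1)].

Definition coefficient_map (j : 'I_n) (a : 'rV[R]_(nparam M)) :
    'rV[R]_(size (io_coefs j)) :=
  \row_k (nth 0 (io_coefs j) k).@[a ord0].

End Coefficients.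

(* Lebesgue measure zero: countable covers by boxes of arbitrarily small total
   volume. *)
Definition measure_zero (R : realType) (N : nat) (A : set 'rV[R]_N) : Prop :=
  forall eps : R, 0 < eps ->
    exists lo hi : nat -> 'rV[R]_N,
      [/\ forall k i, lo k ord0 i <= hi k ord0 i,
          forall x, A x ->
            exists k, forall i, lo k ord0 i <= x ord0 i <= hi k ord0 i
        & forall m : nat,
            \sum_(k < m) \prod_(i < N) (hi k ord0 i - lo k ord0 i) <= eps].

Definition locally_identifiable (R : realType) (n : nat) (M : model n)
    (j : 'I_n) : Prop :=
  exists2 Z : set 'rV[R]_(nparam M), measure_zero Z &
    forall a, ~ Z a ->
      exists2 U : set 'rV[R]_(nparam M), nbhs a U &
        {in U &, injective (@coefficient_map R n M j)}.

Section Dimension.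
Variables (R : realType) (k : nat).
Implicit Types (S : set 'rV[R]_k) (d : nat).

Definition vanishing_ideal S : set {mpoly R[k]} :=
  [set p | forall y, S y -> p.@[y ord0] = 0].

Definition prime_ideal (P : {pred {mpoly R[k]}}) : Prop :=
  idealr_closed P /\ prime_idealr_closed P.

(* A strict chain of d + 1 primes of R[y_1, ..., y_k] containing the vanishing
   ideal of S, that is, a chain of length d of primes of R[y] / I(S). *)
Definition has_prime_chain S d : Prop :=
  exists P : nat -> {pred {mpoly R[k]}},
    [/\ forall i, (i <= d)%N -> prime_ideal (P i),
        forall p, vanishing_ideal S p -> p \in P 0%N
      & forall i, (i < d)%N ->
          {subset P i <= P i.+1} /\ ~ {subset P i.+1 <= P i}].

(* The dimension of a (semialgebraic) set is the Krull dimension of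
   R[y] / I(S), i.e. the dimension of its Zariski closure. *)
Definition has_dimension S d : Prop :=
  has_prime_chain S d /\ forall e, has_prime_chain S e -> (e <= d)%N.

End Dimension.

(* Main.v *)
Require Import Defs.
From HB Require Import structures.
From mathcomp Require Import all_boot all_order all_algebra.
From mathcomp Require Import mpoly.
From mathcomp Require Import boolp classical_sets reals topology normedtype.
From mathcomp Require Import functions sequences interval_inference ereal numfun.
From mathcomp Require Import measure measurable_realfun lebesgue_measure.
From mathcomp Require Import lebesgue_integral ring lra.

(** Write N for the number |E| + |In U Out| of parameters of M, and M~ for the
    model with a leak everywhere.  Both sides of the equivalence are shown to say
    that some N coefficients of the input-output equation are algebraically
    independent, for M or, equivalently, for M~.

    Rescaling.  Conjugating a compartmental matrix A by an invertible diagonal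
    matrix D with D_ii = 1 on L = In U Out changes no coefficient.  For a generic
    matrix A of M~, there is exactly one such D for which D A D^-1 has zero column
    sums outside L, that is, for which D A D^-1 is a matrix of M: its diagonal d
    solves the linear system (d^T A)_i = 0 for i not in L, d_i = 1 for i in L.
    Genericity is the non-vanishing of a polynomial; it holds at the matrix of M
    with all parameters 1, where d = 1 is the only solution by a maximum principle,
    since every vertex is connected to L.  Therefore the coefficients of M and
    those of M~ satisfy the same polynomial relations ([coef_relation]).

    Identifiability.  In characteristic 0, algebraically independent polynomials
    can be completed to a family of N polynomials whose Jacobian determinant is not
    zero ([jac_extension]).  If N coefficients are independent, the zero set of
    their Jacobian determinant is null, and the coefficient map is locally injective
    off this set: for polynomials, F x - F y = Q (x, y) (x - y) with Q continuous
    and Q (a, a) the Jacobian matrix at a.  Conversely, suppose that a maximal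
    independent subfamily f of the coefficients has size less than N, and complete
    it to F.  As F is locally open (by the contraction principle), some fibre of f
    has infinitely many points in any given nonempty open set; the other
    coefficients are algebraic over f, hence take finitely many values on that
    fibre, and the coefficient map is not injective there.  Finally the complement
    of a null set is not empty, because boxes covering the unit cube have total
    volume at least 1.

    Dimension.  If P_0 < ... < P_e is a chain of primes and q_i is in P_(i+1) but
    not in P_i, then q_0, ..., q_(e-1) are algebraically independent modulo P_0
    ([prime_chain_indep]).  Conversely, for d independent coefficients, restricting
    to a flag of affine subspaces through a point where their Jacobian matrix has
    rank d gives a chain of d + 1 primes ([algindep_chain]). *)

Set Implicit Arguments.
Unset Strict Implicit.
Unset Printing Implicit Defensive.

Import Order.TTheory GRing.Theory Num.Theory.
Import numFieldNormedType.Exports.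

Local Open Scope classical_set_scope.
Local Open Scope ring_scope.

(** * Composition and differentiation of polynomials *)

(** Induction on a polynomial as an element of the algebra generated by the variables. *)
Lemma mpoly_alg_ind (R : nzRingType) (n : nat) (P : {mpoly R[n]} -> Prop) :
  (forall c, P c%:MP) -> (forall i, P 'X_i) ->
  (forall p q, P p -> P q -> P (p + q)) ->
  (forall p q, P p -> P q -> P (p * q)) -> forall p, P p.
Proof.
move=> PC PX PD PM p; rewrite (mpolyE p).
apply: (big_ind P) => [||m _]; [by rewrite -mpolyC0 | exact: PD |].
rewrite -mul_mpolyC; apply: (PM) => //; rewrite mpolyXE_id.
apply: (big_ind P) => [||i _]; [by rewrite -mpolyC1 | exact: PM |].
by elim: (m i) => [|k IH]; rewrite ?expr0 -?mpolyC1 // exprS; apply: PM.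
Qed.

(** The chain rule for a derivation d of S that kills the scalars; used for the
    partial derivatives and for the derivative of univariate polynomials. *)
Lemma mmap_chain_rule (R : nzRingType) (S : comNzRingType) (n : nat)
    (f : {rmorphism R -> S}) (h : 'I_n -> S) (d : S -> S) :
    (forall c, d (f c) = 0) -> (forall x y, d (x + y) = d x + d y) ->
    (forall x y, d (x * y) = d x * y + x * d y) ->
  forall p : {mpoly R[n]},
    d (mmap f h p) = \sum_i mmap f h p^`M(i) * d (h i).
Proof.
move=> dC dD dM; elim/mpoly_alg_ind => [c|k|p q IHp IHq|p q IHp IHq].
- by rewrite mmapC dC big1 // => i _; rewrite mderivC mmap0 mul0r.
- rewrite mmapX mmap1U (bigD1 k) //= big1 ?addr0 => [|i ik].
    by rewrite mderivX mnm1E eqxx scale1r -[X in (X - _)%MM]add0m addmK mpolyX0 rmorph1 mul1r.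
  by rewrite mderivX mnm1E eq_sym (negPf ik) scale0r mmap0 mul0r.
- rewrite mmapD dD IHp IHq -big_split /=; apply: eq_bigr => i _.
  by rewrite mderivD mmapD mulrDl.
- rewrite rmorphM dM IHp IHq mulr_suml mulr_sumr -big_split /=.
  apply: eq_bigr => i _; rewrite mderivM mmapD !rmorphM /= mulrDl mulrA.
  by congr (_ + _); rewrite -!mulrA; congr (_ * _); rewrite mulrC.
Qed.

Section Composition.
Variables (R : comNzRingType) (m N : nat).
Implicit Types (f : 'I_m -> {mpoly R[N]}) (G : {mpoly R[m]}).

(** The polynomial G (f_0, ..., f_(m-1)). It is a variant of [comp_mpoly] in which the
    family f is a function rather than a tuple. *)
Definition pcomp f G : {mpoly R[N]} := mmap (@mpolyC N R) f G.

HB.instance Definition _ f := GRing.RMorphism.copy (pcomp f) (pcomp f).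

Lemma pcompC f c : pcomp f c%:MP = c%:MP.
Proof. exact: mmapC. Qed.

Lemma pcompX f i : pcomp f 'X_i = f i.
Proof. by rewrite /pcomp mmapX mmap1U. Qed.

Lemma meval_pcomp f G (v : 'I_N -> R) :
  (pcomp f G).@[v] = G.@[fun i => (f i).@[v]].
Proof.
elim/mpoly_alg_ind: G => [c|k|p q IHp IHq|p q IHp IHq].
- by rewrite pcompC !mevalC.
- by rewrite pcompX mevalXU.
- by rewrite rmorphD !mevalD IHp IHq.
- by rewrite rmorphM !mevalM IHp IHq.
Qed.

Lemma mderiv_pcomp f G l :
  (pcomp f G)^`M(l) = \sum_i pcomp f G^`M(i) * (f i)^`M(l).
Proof.
apply: mmap_chain_rule => [c|x y|x y]; first exact: mderivC.
  exact: mderivD.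
exact: mderivM.
Qed.

(** The polynomials f_i are algebraically independent over R. *)
Definition algindep f := forall G, pcomp f G = 0 -> G = 0.

End Composition.

Lemma eq_pcomp (R : comNzRingType) (m N : nat) (f g : 'I_m -> {mpoly R[N]}) :
  f =1 g -> pcomp f =1 pcomp g.
Proof. by move=> fg G; congr (pcomp _ G); apply: boolp.funext. Qed.

Section Derivatives.
Variables (R : numDomainType) (n : nat).
Implicit Types p : {mpoly R[n]}.

Lemma msize_mderiv_lt p i : p != 0 -> (msize p^`M(i) < msize p)%N.
Proof.
move=> p0; rewrite msizeE; apply: leq_ltn_trans (_ : ((msize p).-1 < _)%N).
  apply/bigmax_leqP_seq => m; rewrite mcoeff_msupp mcoeff_deriv => + _.
  rewrite -mulr_natr mulf_eq0 negb_or -mcoeff_msupp => /andP[/msize_mdeg_lt].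
  by rewrite mdegD mdeg1 addn1; case: (msize p).
by rewrite prednK ?lt0n ?msize_poly_eq0.
Qed.

Lemma mderiv_all0 p : (forall i, p^`M(i) = 0) -> p = (p@_0%MM)%:MP.
Proof.
move=> d0; apply/mpolyP => m; rewrite mcoeffC.
have [->|m0] := eqVneq 0%MM m; first by rewrite mulr1.
rewrite mulr0; have [i mi] : exists i, m i != 0%N.
  apply/existsP; apply: contra_neqT m0; rewrite negb_exists => /forallP m0.
  by apply/mnmP => i; rewrite mnm0E; have /eqP := negbNE (m0 i).
have := congr1 (mcoeff (m - U_(i))%MM) (d0 i).
rewrite mcoeff_deriv mcoeff0 submK => [/eqP|].
  by rewrite mulrn_eq0 => /eqP.
by apply/mnm_lepP => j; rewrite mnm1E; case: eqP => // <-; rewrite lt0n.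
Qed.

Lemma mderiv0_msupp p i m : p^`M(i) = 0 -> m \in msupp p -> m i = 0%N.
Proof.
move=> d0; apply: contraTeq => mi; rewrite mcoeff_msupp negbK.
have := congr1 (mcoeff (m - U_(i))%MM) d0.
rewrite mcoeff_deriv mcoeff0 submK => [/eqP|].
  by rewrite mulrn_eq0.
by apply/mnm_lepP => j; rewrite mnm1E; case: eqP => // <-; rewrite lt0n.
Qed.

End Derivatives.

Section Line.
Variables (R : numFieldType) (n : nat).
Implicit Types p : {mpoly R[n]}.

(** The polynomial t |-> p (v + t w). *)
Definition line_restr (v w : 'I_n -> R) p : {poly R} :=
  mmap (@polyC R) (fun l => (v l)%:P + (w l)%:P * 'X) p.

Lemma horner_line_restr v w p t :
  (line_restr v w p).[t] = p.@[fun l => v l + w l * t].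
Proof.
rewrite /line_restr; elim/mpoly_alg_ind: p => [c|k|p q IHp IHq|p q IHp IHq].
- by rewrite mmapC hornerC mevalC.
- by rewrite mmapX mmap1U mevalXU !hornerE.
- by rewrite rmorphD hornerD IHp IHq mevalD.
- by rewrite rmorphM hornerM IHp IHq mevalM.
Qed.

Lemma deriv_line_restr v w p :
  (line_restr v w p)^`() = \sum_i line_restr v w p^`M(i) * (w i)%:P.
Proof.
rewrite /line_restr (@mmap_chain_rule _ _ _ (@polyC R) _ (@deriv R)) => [|c|x y|x y].
- apply: eq_bigr => i _; rewrite derivD derivC derivM derivC derivX.
  by rewrite mul0r add0r add0r mulr1.
- exact: derivC.
- exact: derivD.
- exact: derivM.
Qed.

Lemma poly_eval0 (p : {poly R}) : (forall t, p.[t] = 0) -> p = 0.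
Proof.
move=> p0; apply/eqP; apply: contraT => np.
have u : uniq [seq (i%:R : R) | i <- iota 0 (size p)].
  rewrite map_inj_in_uniq ?iota_uniq // => i j _ _ /eqP.
  by rewrite eqr_nat => /eqP.
have /(max_poly_roots np) : all (root p) [seq (i%:R : R) | i <- iota 0 (size p)].
  by apply/allP => x _; rewrite rootE p0.
by rewrite u size_map size_iota ltnn => /(_ isT).
Qed.

(** A polynomial that vanishes everywhere is 0: its partial derivatives vanish
    everywhere, hence are 0 by induction on the degree. *)
Lemma meval_all0 p : (forall v, p.@[v] = 0) -> p = 0.
Proof.
have [k] := ubnP (msize p); elim: k p => // k IH p; rewrite ltnS => pk p0.
have [//|np] := eqVneq p 0.
have d0 i : p^`M(i) = 0.
  apply: IH => [|v]; first exact: leq_trans (msize_mderiv_lt i np) pk.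
  pose w l : R := (l == i)%:R.
  have : line_restr v w p = 0.
    by apply: poly_eval0 => t; rewrite horner_line_restr p0.
  move/(congr1 (fun q => q^`().[0])); rewrite deriv_line_restr deriv0 horner0.
  rewrite (bigD1 i) //= big1 => [|l li].
    rewrite addr0 hornerM hornerC /w eqxx mulr1 horner_line_restr => <-.
    by apply: meval_eq => l; rewrite mulr0 addr0.
  by rewrite /w (negPf li) polyC0 mulr0.
move: (p0 (fun=> 0)); rewrite (mderiv_all0 d0) mevalC => ->.
exact: mpolyC0.
Qed.

Lemma meval_neq0 p : p != 0 -> exists v, p.@[v] != 0.
Proof.
move=> np; have /existsNP[v /eqP pv] : ~ forall v, p.@[v] = 0.
  by move/meval_all0/eqP; apply/negP.
by exists v.
Qed.

End Line.

(** * Algebraic independence and the Jacobian matrix *)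

Section Jacobian.
Variables (R : numFieldType) (m N : nat).
Implicit Types (f : 'I_m -> {mpoly R[N]}) (v : 'I_N -> R).

(** The Jacobian matrix of a family of polynomials, and its value at a point. *)
Definition jac f : 'M[{mpoly R[N]}]_(m, N) := \matrix_(i, l) (f i)^`M(l).

Definition jac_at f v : 'M[R]_(m, N) := map_mx (meval v) (jac f).

Lemma jac_atE f v i l : jac_at f v i l = (f i)^`M(l).@[v].
Proof. by rewrite !mxE. Qed.

Lemma chain_row f G :
  \row_l (pcomp f G)^`M(l) = (\row_i pcomp f G^`M(i)) *m jac f.
Proof.
apply/rowP => l; rewrite !mxE mderiv_pcomp; apply: eq_bigr => i _.
by rewrite !mxE.
Qed.

(** Differentiating a relation G (f) = 0 of least degree gives a linear relation
    between the rows of the Jacobian matrix, with coefficients (d_i G) (f). *)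
Lemma jac_free_algindep f v : row_free (jac_at f v) -> algindep f.
Proof.
case/row_freeP => C JC.
(* With C a right inverse of the Jacobian matrix at v, the Jacobian matrix times
   C is invertible over the fractions, as its determinant is 1 at v. *)
pose Cp : 'M[{mpoly R[N]}]_(N, m) := map_mx (@mpolyC N R) C.
pose D := jac f *m Cp.
have dD : \det D != 0.
  have E : map_mx (meval v) D = 1%:M.
    rewrite map_mxM /= -[RHS]JC; congr (_ *m _).
    by apply/matrixP => i j; rewrite !mxE mevalC.
  apply: contraTneq (oner_neq0 R) => /(congr1 (meval v)).
  by rewrite -det_map_mx E det1 meval0 => ->; rewrite eqxx.
move=> G; have [k] := ubnP (msize G); elim: k G => // k IH G.
rewrite ltnS => Gk fG; have [//|nG] := eqVneq G 0.
have d0 i : G^`M(i) = 0.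
  apply: IH; first exact: leq_trans (msize_mderiv_lt i nG) Gk.
  have u0 : (\row_i pcomp f G^`M(i)) *m jac f = 0.
    by rewrite -chain_row fG; apply/rowP => l; rewrite !mxE mderiv0.
  have := congr1 (fun u => u *m Cp *m \adj D) u0.
  rewrite -[X in X *m _]mulmxA -mulmxA -/D mul_mx_adj mul_mx_scalar !mul0mx.
  by move/rowP => /(_ i)/eqP; rewrite !mxE mulf_eq0 (negPf dD) => /eqP.
move: fG; rewrite (mderiv_all0 d0) pcompC => /eqP.
by rewrite mpolyC_eq0 => /eqP ->; rewrite mpolyC0.
Qed.

End Jacobian.

Lemma msizeM_leS (R : idomainType) (n : nat) (p q : {mpoly R[n]}) (a b : nat) :
  (msize p <= a.+1 -> msize q <= b.+1 -> msize (p * q) <= (a + b).+1)%N.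
Proof.
have [->|p0] := eqVneq p 0; first by rewrite mul0r msize0.
have [->|q0] := eqVneq q 0; first by rewrite mulr0 msize0.
move=> pa qb; rewrite msizeM // -ltnS prednK; last first.
  by rewrite addn_gt0 lt0n msize_poly_eq0 p0.
by rewrite (leq_trans (leq_add pa qb)) // addSn addnS.
Qed.

Lemma msizeX_leS (R : idomainType) (n : nat) (p : {mpoly R[n]}) (d k : nat) :
  (msize p <= d.+1 -> msize (p ^+ k) <= (k * d).+1)%N.
Proof.
move=> pd; elim: k => [|k IH]; first by rewrite expr0 msize1.
by rewrite exprS mulSn; apply: msizeM_leS.
Qed.

Section Counting.
Variables (R : fieldType) (m N : nat) (f : 'I_m -> {mpoly R[N]}).

Lemma pcompZ c (G : {mpoly R[m]}) : pcomp f (c *: G) = c *: pcomp f G.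
Proof. by rewrite /pcomp mmapZ mul_mpolyC. Qed.

(* The monomials in f with exponents less than K have degree less than B, and
   K ^ m > B ^ N when N < m. *)
Let D := (\max_i msize (f i))%N.
Let K := ((m * D + 1) ^ N).+1.
Let B := (K * (m * D + 1))%N.
Let mon k b (e : {ffun 'I_k -> 'I_b}) : 'X_{1..k} := [multinom (e i : nat) | i < k].

Lemma msize_pcomp_mon (e : {ffun 'I_m -> 'I_K}) : (msize (pcomp f 'X_[mon e]) <= B)%N.
Proof.
have H (r : seq 'I_m) :
    (msize (\prod_(i <- r) (f i) ^+ (e i)) <= (\sum_(i <- r) K * D).+1)%N.
  elim: r => [|i r IH]; first by rewrite !big_nil msize1.
  rewrite !big_cons; apply: msizeM_leS => //.
  apply: leq_trans (msizeX_leS (d := D) _ _) _; first by rewrite leqW ?leq_bigmax.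
  by rewrite ltnS leq_mul2r ltnW ?orbT.
rewrite /pcomp mmapX /mmap1; under eq_bigr do rewrite mnmE.
apply: leq_trans (H _) _; rewrite sum_nat_const card_ord /B mulnDr muln1.
by rewrite mulnCA -addn1 leq_add2l.
Qed.

(** More polynomials than variables are algebraically dependent: the monomials of
    partial degrees less than K in the m polynomials are K ^ m in number, and lie in a
    space whose dimension is O (K ^ N). *)
Lemma algdep_many : (N < m)%N -> exists2 G, G != 0 & pcomp f G = 0.
Proof.
move=> Nm; pose E := {ffun 'I_m -> 'I_K}; pose F := {ffun 'I_N -> 'I_B}.
have FE : (#|F| < #|E|)%N.
  rewrite !card_ffun !card_ord /B expnMn.
  apply: leq_trans (_ : (K ^ N.+1 <= _)%N); last by rewrite leq_pexp2l.
  by rewrite expnSr ltn_pmul2l ?expn_gt0.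
pose A : 'M[R]_(#|E|, #|F|) :=
  \matrix_(a, b) (pcomp f 'X_[mon (enum_val a)])@_(mon (enum_val b)).
have /rowV0Pn[u /sub_kermxP uA u0] : kermx A != 0.
  rewrite -mxrank_eq0 mxrank_ker subn_eq0 -ltnNge.
  exact: leq_ltn_trans (rank_leq_col _) FE.
pose G := \sum_a u 0 a *: 'X_[mon (enum_val a)] : {mpoly R[m]}.
exists G.
  apply: contra_neq u0 => G0; apply/rowP => a; rewrite mxE.
  have := congr1 (mcoeff (mon (enum_val a))) G0.
  rewrite /G linear_sum mcoeff0 (bigD1 a) //= big1 => [|b ba].
    by rewrite addr0 mcoeffZ mcoeffX eqxx mulr1.
  rewrite mcoeffZ mcoeffX; case: eqP => [/mnmP e|]; last by rewrite mulr0.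
  case/eqP: ba; apply: enum_val_inj; apply/ffunP => i.
  by apply: val_inj; have := e i; rewrite !mnmE.
rewrite /G rmorph_sum; under eq_bigr do rewrite /= pcompZ.
apply/mpolyP => mu; rewrite linear_sum mcoeff0 /=.
under eq_bigr do rewrite mcoeffZ.
have [muB|muB] := boolP [forall i, mu i < B]%N.
  pose b : F := [ffun i => Ordinal (forallP muB i)].
  have <- : mon b = mu by apply/mnmP => i; rewrite mnmE ffunE.
  transitivity ((u *m A) 0 (enum_rank b)); last by rewrite uA mxE.
  by rewrite mxE; apply: eq_bigr => a _; rewrite mxE enum_rankK.
rewrite big1 // => a _; rewrite memN_msupp_eq0 ?mulr0 //.
apply: msize_mdeg_ge; apply: leq_trans (msize_pcomp_mon _) _.
move: muB; rewrite negb_forall => /existsP[i]; rewrite -leqNgt => /leq_trans; apply.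
by rewrite mdegE (bigD1 i) //= leq_addr.
Qed.

Lemma algindep_leq : algindep f -> (m <= N)%N.
Proof.
move=> fi; rewrite leqNgt; apply/negP => /algdep_many[G G0 /fi Gz].
by rewrite Gz eqxx in G0.
Qed.

End Counting.

Lemma pcomp_pcomp (R : comNzRingType) (k m N : nat) (f : 'I_m -> {mpoly R[N]})
    (g : 'I_k -> {mpoly R[m]}) G :
  pcomp f (pcomp g G) = pcomp (fun i => pcomp f (g i)) G.
Proof.
elim/mpoly_alg_ind: G => [c|l|p q IHp IHq|p q IHp IHq].
- by rewrite !pcompC.
- by rewrite !pcompX.
- by rewrite !rmorphD /= IHp IHq.
- by rewrite !rmorphM /= IHp IHq.
Qed.

Lemma pcomp_id (R : comNzRingType) (m : nat) (G : {mpoly R[m]}) :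
  pcomp (fun i => 'X_i) G = G.
Proof.
elim/mpoly_alg_ind: G => [c|l|p q IHp IHq|p q IHp IHq].
- by rewrite pcompC.
- by rewrite pcompX.
- by rewrite rmorphD /= IHp IHq.
- by rewrite rmorphM /= IHp IHq.
Qed.

Section Fcons.
Variables (R : comNzRingType) (m N : nat).

(** The family x, f_0, ..., f_(m-1). *)
Definition fcons (x : {mpoly R[N]}) (f : 'I_m -> {mpoly R[N]}) : 'I_m.+1 -> {mpoly R[N]} :=
  fun i => oapp f x (unlift ord0 i).

Lemma fcons0 x f : fcons x f ord0 = x.
Proof. by rewrite /fcons unlift_none. Qed.

Lemma fconsS x f i : fcons x f (lift ord0 i) = f i.
Proof. by rewrite /fcons liftK. Qed.

End Fcons.

Section Extension.
Variables (R : numFieldType) (N : nat).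

(** If x is algebraic over the independent family f, some relation between x and f has
    x as a simple root: take a relation of least degree. *)
Lemma algdep_simple m (f : 'I_m -> {mpoly R[N]}) x :
  algindep f -> ~ algindep (fcons x f) ->
  exists2 G, pcomp (fcons x f) G = 0 & pcomp (fcons x f) G^`M(ord0) != 0.
Proof.
move=> fi /existsNP[G /not_implyP[fG /eqP nG]].
have [k] := ubnP (msize G); elim: k G fG nG => // k IH G fG nG; rewrite ltnS => Gk.
have [d0|d0] := eqVneq (pcomp (fcons x f) G^`M(ord0)) 0; last by exists G.
have [dz|dz] := eqVneq G^`M(ord0) 0; last first.
  by apply: IH d0 dz _; apply: leq_trans (msize_mderiv_lt _ nG) Gk.
(* As d_0 G = 0, the value of G does not depend on its first argument; setting it
   to 0 gives a relation between the f_i only. *)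
pose W (l : nat) (h : 'I_m -> {mpoly R[l]}) y := pcomp (fcons y h) G.
have WE l h y : W l h y = W l h 0.
  rewrite /W /pcomp /mmap; apply: eq_big_seq => mu muG; congr (_ * _).
  apply: eq_bigr => i _; case: (unliftP ord0 i) => [j ->|->].
    by rewrite !fconsS.
  by rewrite (mderiv0_msupp dz muG) !expr0.
pose G' := W m (fun i => 'X_i) 0.
have comp0 l (h : 'I_m -> {mpoly R[l]}) : pcomp h G' = W l h 0.
  rewrite /G' /W pcomp_pcomp; apply: eq_pcomp => i.
  case: (unliftP ord0 i) => [j ->|->]; first by rewrite !fconsS pcompX.
  by rewrite !fcons0 rmorph0.
case/eqP: nG; rewrite -[LHS]pcomp_id.
rewrite (_ : pcomp _ G = W _ (fun i => 'X_(lift ord0 i)) 'X_ord0); last first.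
  by apply: eq_pcomp => i; case: (unliftP ord0 i) => [j ->|->]; rewrite ?fconsS ?fcons0.
rewrite WE -comp0 (fi G') ?rmorph0 //.
by rewrite comp0 -(WE _ _ x).
Qed.

(** The Jacobian criterion. As long as a variable is transcendental over f, add it to f.
    When all are algebraic over f, differentiating their relations expresses the standard
    basis in the rows of the Jacobian matrix of f, where the relations are simple. *)
Lemma jac_extension m (f : 'I_m -> {mpoly R[N]}) : algindep f ->
  exists (F : 'I_N -> {mpoly R[N]}) (e : 'I_m -> 'I_N) (v : 'I_N -> R),
    [/\ injective e, forall i, F (e i) = f i & \det (jac_at F v) != 0].
Proof.
have [k] := ubnP (N - m)%N; elim: k m f => // k IH m f; rewrite ltnS => Nmk fi.
have [[j fij]|nj] := pselect (exists j : 'I_N, algindep (fcons 'X_j f)).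
  have mN := algindep_leq fij.
  have [|F [e [v [ei eF dF]]]] := IH _ _ _ fij.
    by apply: leq_trans Nmk; rewrite subnS prednK ?subn_gt0.
  exists F, (e \o lift ord0), v; split=> // [a b /ei/lift_inj //|i].
  by rewrite /= eF fconsS.
have /choice[G HG] : forall j : 'I_N, exists G, pcomp (fcons 'X_j f) G = 0 /\
    pcomp (fcons 'X_j f) G^`M(ord0) != 0.
  move=> j; have [|G] := algdep_simple (x := 'X_j) fi; last by exists G.
  by move=> H; apply: nj; exists j.
pose h j := pcomp (fcons 'X_j f) (G j)^`M(ord0).
(* At v, all the relations G_j are simple in the variable j. *)
have [v] : exists v, (\prod_j h j).@[v] != 0.
  by apply: meval_neq0; apply/prodf_neq0 => j _; have [] := HG j.
rewrite rmorph_prod => /prodf_neq0 /= hv.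
pose W : 'M[R]_(N, m) :=
  \matrix_(j, i) - (pcomp (fcons 'X_j f) (G j)^`M(lift ord0 i)).@[v].
have WJ : W *m jac_at f v = diag_mx (\row_j (h j).@[v]).
  apply/matrixP => j l; rewrite !mxE.
  have [/(congr1 (fun p => p^`M(l).@[v])) + _] := HG j.
  rewrite mderiv_pcomp mderiv0 meval0 big_ord_recl fcons0 mevalD mevalM.
  rewrite [X in _ + X]raddf_sum /= mderivX mnm1E => /eqP.
  rewrite addr_eq0 => /eqP E; transitivity ((h j).@[v] * (j == l)%:R); last first.
    by rewrite mulr_natr.
  transitivity ((h j).@[v] * ((j == l)%:R *: 'X_[R, U_(j) - U_(l)]).@[v]).
    rewrite E -sumrN. apply/eq_bigr => i _.
    by rewrite fconsS mevalM !mxE mulNr.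
  congr (_ * _); have [->|_] := eqVneq j l; last by rewrite scale0r meval0.
  by rewrite scale1r -[X in (X - _)%MM]add0m addmK mpolyX0 meval1.
have dWJ : \det (W *m jac_at f v) != 0.
  by rewrite WJ det_diag; apply/prodf_neq0 => j _; rewrite mxE hv.
have mN := algindep_leq fi.
have Nm : (N <= m)%N.
  have /mxrank_unit <- : W *m jac_at f v \in unitmx by rewrite unitmxE unitfE.
  by rewrite (leq_trans (mxrankM_maxl _ _)) ?rank_leq_col.
have eNm : m = N by apply/eqP; rewrite eqn_leq mN Nm.
subst m; exists f, id, v; split=> //.
by move: dWJ; rewrite det_mulmx mulf_eq0 negb_or => /andP[].
Qed.

End Extension.

(** * Polynomial maps with an invertible Jacobian matrix *)

(** Joins the complete and the normed structures of matrices. *)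
HB.instance Definition _ (R : realType) (m n : nat) := Complete.on 'M[R]_(m, n).

Section Slopes.
Variables (R : realType) (N : nat).
Implicit Types (p : {mpoly R[N]}) (x y a : 'rV[R]_N).

Lemma continuous_prod (T : topologicalType) (I : Type) (r : seq I) (P : pred I)
    (f : I -> T -> R) : (forall i, continuous (f i)) ->
  continuous (fun t => \prod_(i <- r | P i) f i t).
Proof.
move=> cf; elim: r => [|i r IH].
  by under eq_fun do rewrite big_nil; exact: cst_continuous.
under eq_fun do rewrite big_cons; case: (P i) => // t.
by apply: continuousM; [exact: cf | exact: IH].
Qed.

Lemma continuous_sum (T : topologicalType) (I : Type) (r : seq I) (P : pred I)
    (f : I -> T -> R) : (forall i, continuous (f i)) ->
  continuous (fun t => \sum_(i <- r | P i) f i t).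
Proof.
move=> cf; elim: r => [|i r IH].
  by under eq_fun do rewrite big_nil; exact: cst_continuous.
under eq_fun do rewrite big_cons; case: (P i) => // t.
by apply: continuousD; [exact: cf | exact: IH].
Qed.

Lemma continuous_det (T : topologicalType) n (A : T -> 'M[R]_n) :
  (forall i j, continuous (fun t => A t i j)) -> continuous (fun t => \det (A t)).
Proof.
move=> cA; apply: continuous_sum => s x.
by apply: cvgM; [exact: cvg_cst | apply: continuous_prod => i; exact: cA].
Qed.

Lemma continuous_meval p : continuous (fun x => p.@[x ord0]).
Proof.
elim/mpoly_alg_ind: p => [c|k|p q IHp IHq|p q IHp IHq].
- by under eq_fun do rewrite mevalC; exact: cst_continuous.
- by under eq_fun do rewrite mevalXU; exact: coord_continuous.
- by under eq_fun do rewrite mevalD; move=> x; apply: continuousD; [exact: IHp|exact: IHq].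
- by under eq_fun do rewrite mevalM; move=> x; apply: continuousM; [exact: IHp|exact: IHq].
Qed.

(** The increments of a polynomial, with continuous slopes that extend the partial
    derivatives to pairs of points. *)
Lemma mpoly_slope p : exists q : 'I_N -> 'rV[R]_N * 'rV[R]_N -> R,
  [/\ forall x y, p.@[x ord0] - p.@[y ord0] =
        \sum_i q i (x, y) * (x ord0 i - y ord0 i),
      forall i, continuous (q i) &
      forall i a, q i (a, a) = p^`M(i).@[a ord0]].
Proof.
elim/mpoly_alg_ind: p => [c|k|p p' [q [qE qc qd]] [q' [qE' qc' qd']]
                             |p p' [q [qE qc qd]] [q' [qE' qc' qd']]].
- exists (fun _ _ => 0); split=> [x y|i|i a].
  + by rewrite !mevalC subrr big1 // => i _; rewrite mul0r.
  + exact: cst_continuous.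
  + by rewrite mderivC meval0.
- exists (fun i _ => (i == k)%:R); split=> [x y|i|i a].
  + rewrite !mevalXU (bigD1 k) //= eqxx mul1r big1 ?addr0 // => i /negPf ->.
    by rewrite mul0r.
  + exact: cst_continuous.
  + rewrite mderivX mnm1E eq_sym; have [->|_] := eqVneq i k; last by rewrite scale0r meval0.
    by rewrite scale1r -[X in (X - _)%MM]add0m addmK mpolyX0 meval1.
- exists (fun i xy => q i xy + q' i xy); split=> [x y|i xy|i a].
  + rewrite !mevalD opprD addrACA qE qE' -big_split /=.
    by apply: eq_bigr => i _; rewrite mulrDl.
  + by apply: continuousD; [exact: qc | exact: qc'].
  + by rewrite mderivD mevalD qd qd'.
- exists (fun i (xy : 'rV[R]_N * 'rV[R]_N) =>
    p.@[xy.1 ord0] * q' i xy + q i xy * p'.@[xy.2 ord0]).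
  split=> [x y|i xy|i a].
  + rewrite !mevalM /= -(subrKA (p.@[x ord0] * p'.@[y ord0])) -mulrBr -mulrBl qE qE'.
    rewrite [X in X + _]mulr_sumr [X in _ + X]mulr_suml -big_split /=.
    by apply: eq_bigr => i _; ring.
  + apply: cvgD; apply: cvgM; [|exact: qc'|exact: qc|].
    * apply: (@continuous_comp _ _ _ (fun xy : 'rV[R]_N * 'rV[R]_N => xy.1)
        (fun x : 'rV[R]_N => p.@[x ord0])); first exact: cvg_fst.
      exact: continuous_meval.
    * apply: (@continuous_comp _ _ _ (fun xy : 'rV[R]_N * 'rV[R]_N => xy.2)
        (fun x : 'rV[R]_N => p'.@[x ord0])); first exact: cvg_snd.
      exact: continuous_meval.
  + by rewrite mderivM mevalD !mevalM /= qd qd' addrC.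
Qed.


Lemma mpoly_family_slope m (F : 'I_m -> {mpoly R[N]}) :
  exists Q : 'rV[R]_N * 'rV[R]_N -> 'M[R]_(m, N),
  [/\ forall x y i, (F i).@[x ord0] - (F i).@[y ord0] =
        \sum_l Q (x, y) i l * (x ord0 l - y ord0 l),
      forall i l, continuous (fun xy => Q xy i l) &
      forall a, Q (a, a) = jac_at F (a ord0)].
Proof.
have /choice[q Hq] := fun i => mpoly_slope (F i).
exists (fun xy => \matrix_(i, l) q i l xy); split=> [x y i|i l|a].
- have [-> _ _] := Hq i; apply: eq_bigr => l _; by rewrite mxE.
- have [_ qc _] := Hq i; under eq_fun do rewrite mxE; exact: qc.
- by apply/matrixP => i l; rewrite mxE jac_atE; have [_ _ ->] := Hq i.
Qed.

Lemma mpoly_locally_injective (F : 'I_N -> {mpoly R[N]}) a :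
    \det (jac_at F (a ord0)) != 0 ->
  exists2 U : set 'rV[R]_N, nbhs a U &
    forall x y, U x -> U y -> (forall i, (F i).@[x ord0] = (F i).@[y ord0]) -> x = y.
Proof.
have [Q [QE Qc Qa]] := mpoly_family_slope F; rewrite -Qa => da.
have : \forall xy \near (a, a), \det (Q xy) != 0.
  exact: (cvgr_neq0 _ (@continuous_det _ _ Q Qc (a, a)) da).
case=> -[A B] /= [aA aB] AB; exists (A `&` B); first exact: filterI.
move=> x y [Ax Bx] [Ay By] Fxy; have dQ := AB (x, y) (conj Ax By).
have Qu : Q (x, y) \in unitmx by rewrite unitmxE unitfE.
have : Q (x, y) *m (x - y)^T = 0.
  apply/matrixP => i k; rewrite mxE [RHS]mxE (ord1 k).
  transitivity ((F i).@[x ord0] - (F i).@[y ord0]); last by rewrite Fxy subrr.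
  by rewrite QE; apply: eq_bigr => l _; rewrite !mxE.
move/(congr1 (mulmx (invmx (Q (x, y))))); rewrite mulKmx // mulmx0 => /eqP.
by rewrite trmx_eq0 subr_eq0 => /eqP.
Qed.

Lemma ler_mx_norm_mul m n k (u : 'M[R]_(m, n)) (A : 'M[R]_(n, k)) (e : R) : 0 <= e ->
  (forall i j, `|A i j| <= e) -> `|u *m A| <= n%:R * e * `|u|.
Proof.
move=> e0 Ae; rewrite [leLHS]/Num.Def.normr /= mx_normrE.
apply/bigmax_leP; split=> [|[i j] _ /=].
  by rewrite !mulr_ge0.
rewrite mxE (le_trans (ler_norm_sum _ _ _))//.
apply: (@le_trans _ _ (\sum_(l < n) e * `|u|)); last first.
  by rewrite sumr_const card_ord -mulrA mulr_natl.
apply: ler_sum => l _; rewrite normrM mulrC ler_pM //.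
rewrite [leRHS]/Num.Def.normr /= mx_normrE.
by apply/bigmax_geP; right; exists (i, l).
Qed.


(** A polynomial map is open at a point where its Jacobian determinant is not zero: the
    solution of F x = w is the fixed point of x |-> x - (F x - w) J^-1, a contraction. *)
Lemma mpoly_locally_open (F : 'I_N -> {mpoly R[N]}) a (U : set 'rV[R]_N) :
    \det (jac_at F (a ord0)) != 0 -> nbhs a U ->
  exists2 e : R, 0 < e & forall w : 'rV[R]_N,
    `|(\row_i (F i).@[a ord0]) - w| <= e ->
    exists2 x, U x & forall i, (F i).@[x ord0] = w ord0 i.
Proof.
have [Q [QE Qc Qa]] := mpoly_family_slope F => da aU.
pose J : 'M[R]_N := (jac_at F (a ord0))^T.
have Ju : J \in unitmx by rewrite unitmx_tr unitmxE unitfE.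
pose V (x : 'rV[R]_N) : 'rV[R]_N := \row_i (F i).@[x ord0].
have VE x y : V x - V y = (x - y) *m (Q (x, y))^T.
  apply/rowP => i; rewrite !mxE QE; apply: eq_bigr => l _.
  by rewrite !mxE mulrC.
pose E xy := 1%:M - (Q xy)^T *m invmx J.
have Ec i l : continuous (fun xy => E xy i l).
  rewrite (_ : (fun _ => _) = fun xy =>
      (i == l)%:R - \sum_k Q xy k i * invmx J k l); last first.
    by apply/funext => xy; rewrite !mxE; under eq_bigr do rewrite mxE.
  move=> xy; apply: cvgB; first exact: cvg_cst.
  apply: continuous_sum => k {}xy; apply: cvgM; last exact: cvg_cst.
  exact: Qc.
have Ea : E (a, a) = 0 by rewrite /E Qa mulmxV // subrr.
pose eps : R := (2 * N.+1%:R)^-1.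
have eps0 : 0 < eps by rewrite invr_gt0 mulr_gt0.
have Neps : N%:R * eps <= 2^-1.
  rewrite /eps invfM mulrCA ler_piMr // ler_pdivrMr // mul1r ler_nat.
  exact: leqnSn.
have : \forall xy \near (a, a), forall i l, `|E xy i l| <= eps.
  have FF : Filter (nbhs (a, a)) by exact: nbhs_filter.
  apply: (filter_forall (F := nbhs (a, a))
    (f := fun i xy => forall l, `|E xy i l| <= eps)) => i.
  apply: (filter_forall (F := nbhs (a, a)) (f := fun l xy => `|E xy i l| <= eps)) => l.
  have := @Ec i l (a, a); rewrite /continuous_at Ea mxE => /cvgr0_norm_le.
  exact.
case=> -[A B] /= [aA aB] AB.
have /nbhs_ballP[r /= r0 rABU] : nbhs a (A `&` B `&` U) by do 2?[apply: filterI].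
pose d := r / 2; have d0 : 0 < d by rewrite divr_gt0.
pose D := [set x : 'rV[R]_N | `|a - x| <= d].
have Dsub x : D x -> (A `&` B `&` U) x.
  move=> Dx; apply: rABU; rewrite -ball_normE /=; apply: le_lt_trans Dx _.
  by rewrite ltr_pdivrMr // ltr_pMr // ltr1n.
pose C := N%:R * `|invmx J| + 1.
have C0 : 0 < C by rewrite ltr_wpDl // mulr_ge0.
exists (d / 2 / C); first by rewrite !divr_gt0.
move=> w; rewrite -/(V a) => Vaw.
pose T x := x - (V x - w) *m invmx J.
have TE x y : T x - T y = (x - y) *m E (x, y).
  rewrite /T /E mulmxBr mulmx1 mulmxA -VE.
  have -> : V x - V y = (V x - w) - (V y - w) by rewrite opprB addrA addrNK.
  rewrite [in RHS]mulmxBl; move: (_ *m _) (_ *m _) => b c.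
  by rewrite !opprB addrACA [RHS]addrACA; congr (_ + _); rewrite addrC.
have Tlip x y : D x -> D y -> `|T x - T y| <= 2^-1 * `|x - y|.
  move=> /Dsub[[Ax Bx] _] /Dsub[[Ay By] _]; rewrite TE.
  apply: le_trans (ler_mx_norm_mul _ (ltW eps0) (AB (x, y) (conj Ax By))) _.
  by rewrite ler_wpM2r.
have Ta : `|a - T a| <= d / 2.
  rewrite /T opprB addrCA subrr addr0.
  apply: le_trans (@ler_mx_norm_mul _ _ _ _ _ `|invmx J| _ _) _ => // [i j|].
    by rewrite [leRHS]/Num.Def.normr /= mx_normrE; apply/bigmax_geP; right; exists (i, j).
  apply: (@le_trans _ _ (C * `|V a - w|)).
    by rewrite ler_wpM2r // /C lerDl.
  by rewrite mulrC -ler_pdivlMr.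
have Tfun : {homo T : x / D x >-> D x}.
  move=> x Dx; rewrite /D /=.
  rewrite -(subrKA (T a)) (le_trans (ler_normD _ _)) //.
  rewrite [leRHS](splitr d) lerD // (le_trans (Tlip _ _ _ Dx)) //.
    by rewrite /D /= subrr normr0 ltW.
  by rewrite mulrC ler_pM2r // invr_gt0.
have Dcl : closed D by exact: closed_closed_ball_.
have [] := @banach_fixed_point R 'rV[R]_N D (mkfun Tfun).
- exists 2^-1%:nng; split.
    by rewrite /= invf_lt1 // ltr1n.
  move=> [x y] [Dx Dy] /=; exact: Tlip.
- exact: Dcl.
- by exists a; rewrite /D /= subrr normr0 ltW.
move=> x Dx xT; exists x; first by have [] := Dsub x Dx.
have /eqP : (V x - w) *m invmx J = 0.
  by move/eqP: xT; rewrite /mkfun /T eq_sym subr_eq addrC -subr_eq subrr eq_sym => /eqP.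
move/eqP/(congr1 (mulmx^~ J)); rewrite mulmxKV // mul0mx => /eqP.
by rewrite subr_eq0 => /eqP/rowP Vw i; rewrite -Vw mxE.
Qed.

End Slopes.

(** * Null sets *)

Lemma ler_sum_subseq_uniq (R : numDomainType) (T : eqType) (s s' : seq T) (F : T -> R) :
  uniq s -> uniq s' -> {subset s <= s'} -> (forall t, 0 <= F t) ->
  \sum_(t <- s) F t <= \sum_(t <- s') F t.
Proof.
move=> us us' ss' F0.
rewrite (perm_big (seq.filter (mem s) s')) /=.
  rewrite big_filter [leRHS](bigID (mem s)) /= lerDl.
  by apply: sumr_ge0 => t _; exact: F0.
apply: uniq_perm => // [|t]; first exact: filter_uniq.
by rewrite mem_filter /=; case: (boolP (t \in s)) => // ts; rewrite (ss' t ts).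
Qed.

Section NullSets.
Variables (R : realType) (N : nat).
Hypothesis N0 : (0 < N)%N.
Implicit Types (A B : set 'rV[R]_N).

Let vol (lo hi : 'rV[R]_N) : R := \prod_(i < N) (hi ord0 i - lo ord0 i).

(** The covering boxes may be indexed by any countable type. The hypothesis 0 < N is
    needed, because in dimension 0 every box has volume 1. *)
Lemma measure_zero_cover A :
  (forall eps : R, 0 < eps -> exists (I : countType) (lo hi : I -> 'rV[R]_N),
    [/\ forall k i, lo k ord0 i <= hi k ord0 i,
        forall x, A x -> exists k, forall i, lo k ord0 i <= x ord0 i <= hi k ord0 i &
        forall s : seq I, uniq s -> \sum_(k <- s) vol (lo k) (hi k) <= eps]) ->
  measure_zero A.
Proof.
move=> HA eps /HA[I [lo [hi [lohi cov sm]]]].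
exists (fun t => oapp lo 0 (pickle_inv t)), (fun t => oapp hi 0 (pickle_inv t)); split.
- by move=> t i; case: pickle_inv => //=.
- by move=> x /cov[k kx]; exists (pickle k); rewrite pickleK_inv.
move=> m; rewrite -(big_mkord xpredT
  (fun t => vol (oapp lo 0 (pickle_inv t)) (oapp hi 0 (pickle_inv t)))).
have us : uniq (pmap (@pickle_inv I) (iota 0 m)).
  by apply: pmap_uniq (iota_uniq _ _); exact: pickle_invK.
apply: le_trans (sm _ us); rewrite /index_iota subn0 le_eqVlt; apply/orP; left; apply/eqP.
elim: (iota 0 m) => [|t s IH]; first by rewrite !big_nil.
rewrite big_cons IH /=; case: pickle_inv => [k|] /=; first by rewrite big_cons.
by rewrite {1}/vol (bigD1 (Ordinal N0)) //= mxE subrr mul0r add0r.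
Qed.

Lemma measure_zero_sub A B : A `<=` B -> measure_zero B -> measure_zero A.
Proof.
move=> AB mB eps /mB[lo [hi [lohi cov sm]]]; exists lo, hi; split=> // x /AB.
exact: cov.
Qed.

Lemma sum_half_pow (m : nat) : \sum_(k < m) (2 ^- k.+1 : R) <= 1.
Proof.
have -> : \sum_(k < m) (2 ^- k.+1 : R) = 1 - 2 ^- m.
  elim: m => [|m IH]; first by rewrite big_ord0 expr0 invr1 subrr.
  rewrite big_ord_recr IH /= exprS invfM; lra.
by rewrite lerBlDr lerDl invr_ge0 exprn_ge0.
Qed.

Lemma vol_ge0 (lo hi : 'rV[R]_N) : (forall i, lo ord0 i <= hi ord0 i) -> 0 <= vol lo hi.
Proof. by move=> H; apply: prodr_ge0 => i _; rewrite subr_ge0. Qed.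

Lemma measure_zero_bigcup (T : countType) (A : T -> set 'rV[R]_N) :
  (forall t, measure_zero (A t)) -> measure_zero (\bigcup_t A t).
Proof.
move=> mA; apply: measure_zero_cover => eps eps0.
have e0 (t : T) : 0 < eps * 2 ^- (pickle t).+1 by rewrite mulr_gt0 // invr_gt0 exprn_gt0.
have /choice[lo /choice[hi H]] := fun t => mA t _ (e0 t).
exists (T * nat)%type, (fun p => lo p.1 p.2), (fun p => hi p.1 p.2).
split=> [[t l] i|x [t _ Atx]|s us].
- by have [] := H t.
- by have [_ /(_ _ Atx)[k kx] _] := H t; exists (t, k).
pose F (p : T * nat) := vol (lo p.1 p.2) (hi p.1 p.2).
have F0 p : 0 <= F p by apply: vol_ge0 => i; have [] := H p.1.
pose s1 := undup (map fst s); pose L := (\max_(p <- s) p.2).+1.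
apply: (@le_trans _ _ (\sum_(p <- [seq (t, l) | t <- s1, l <- iota 0 L]) F p)).
  apply: ler_sum_subseq_uniq => //.
    by apply: allpairs_uniq => [||[? ?] [? ?]//]; [exact: undup_uniq | exact: iota_uniq].
  move=> [t l] ts; apply/allpairsP; exists (t, l); split=> //.
    by rewrite mem_undup; apply/mapP; exists (t, l).
  by rewrite mem_iota add0n ltnS (big_rem _ ts) /= leq_max leqnn.
rewrite big_allpairs.
apply: (@le_trans _ _ (\sum_(t <- s1) eps * 2 ^- (pickle t).+1)).
  apply: ler_sum => t _; have [_ _ /(_ L)] := H t.
  by rewrite -(big_mkord xpredT (fun l => F (t, l))) /index_iota subn0.
rewrite -mulr_sumr ler_piMr ?(ltW eps0) // -(big_map pickle xpredT (fun k => (2 ^- k.+1 : R))).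
set ks := map _ _; apply: le_trans (sum_half_pow (\max_(k <- ks) k).+1).
rewrite -(big_mkord xpredT (fun k => (2 ^- k.+1 : R))).
apply: ler_sum_subseq_uniq => [||k kks|k]; rewrite ?iota_uniq ?invr_ge0 ?exprn_ge0 //.
- by rewrite map_inj_uniq ?undup_uniq //; exact: pcan_inj pickleK.
- by rewrite mem_index_iota /= ltnS (big_rem _ kks) /= leq_max leqnn.
Qed.

Lemma subinterval (h u : R) (K : nat) : 0 <= u -> u <= K.+1%:R * h ->
  exists k : 'I_K.+1, k%:R * h <= u <= k.+1%:R * h.
Proof.
move=> u0; elim: K => [|K IH] uK; first by exists ord0; rewrite mul0r u0.
have [/IH[k kP]|Ku] := leP u (K.+1%:R * h).
  by exists (widen_ord (leqnSn _) k).
by exists ord_max; rewrite uK ltW.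
Qed.

(** A bounded part of a Lipschitz graph over the coordinates other than i is null: divide
    the cube into K ^ (N - 1) columns of width h; the part of the graph in each of them is
    contained in a box of height 2 C h. *)
Lemma measure_zero_graph A (q : 'rV[R]_N) (rho C : R) (i : 'I_N) :
  0 <= rho -> 0 <= C -> (forall x, A x -> forall l, `|x ord0 l - q ord0 l| <= rho) ->
  (forall x y, A x -> A y -> forall d, 0 <= d ->
     (forall l, l != i -> `|x ord0 l - y ord0 l| <= d) ->
     `|x ord0 i - y ord0 i| <= C * d) ->
  measure_zero A.
Proof.
move=> rho0 C0 Aq Alip; apply: measure_zero_cover => eps eps0.
pose V := (2 * rho) ^+ N.-1 * (2 * C * (2 * rho)).
pose K := Num.truncn (V / eps).
have K1 : (K.+1%:R : R) != 0 by rewrite pnatr_eq0.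
have VK : V / K.+1%:R <= eps.
  rewrite ler_pdivrMr // mulrC -ler_pdivrMr //; apply: ltW; exact: truncnS_gt.
pose h := 2 * rho / K.+1%:R.
have h0 : 0 <= h by rewrite !mulr_ge0.
(* Columns are indexed by the functions that are 0 at i. *)
pose P l : pred 'I_K.+1 := if l == i then pred1 ord0 else predT.
pose col (f : {ffun 'I_N -> 'I_K.+1}) : set 'rV[R]_N := [set x | A x /\ forall l, l != i ->
  (f l)%:R * h <= x ord0 l - q ord0 l + rho <= (f l).+1%:R * h].
pose pt f : 'rV[R]_N := xget 0 (col f).
pose lo (f : {ffun 'I_N -> 'I_K.+1}) : 'rV[R]_N := \row_l
  if f \in family P then
    if l == i then pt f ord0 i - C * h else q ord0 l - rho + (f l)%:R * h else 0.
pose hi (f : {ffun 'I_N -> 'I_K.+1}) : 'rV[R]_N := \row_l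
  if f \in family P then
    if l == i then pt f ord0 i + C * h else q ord0 l - rho + (f l).+1%:R * h else 0.
have lohi f l : lo f ord0 l <= hi f ord0 l.
  rewrite !mxE; case: ifP => // _; case: ifP => _; last by rewrite lerD2l ler_wpM2r // ler_nat.
  by have := mulr_ge0 C0 h0; lra.
exists {ffun 'I_N -> 'I_K.+1}, lo, hi; split=> [//|x Ax|s us].
- have /choice[g Hg] : forall l, exists k : 'I_K.+1,
      k%:R * h <= x ord0 l - q ord0 l + rho <= k.+1%:R * h.
    move=> l; have := Aq x Ax l; rewrite ler_norml => /andP[Al1 Al2].
    apply: subinterval; first lra.
    by rewrite /h mulrC divfK ?pnatr_eq0 //; lra.
  pose f : {ffun 'I_N -> 'I_K.+1} := [ffun l => if l == i then ord0 else g l].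
  have fP : f \in family P.
    by apply/familyP => l; rewrite /P ffunE; case: ifP => // _; rewrite inE.
  have cx : col f x by split=> // l /negPf li; rewrite ffunE li.
  have [Ap pc] : col f (pt f) := xgetPex 0 (ex_intro _ x cx).
  exists f => l; rewrite !mxE fP; case: (eqVneq l i) => [->|li].
    have : `|x ord0 i - pt f ord0 i| <= C * h.
      apply: Alip => // l' li'; have [_ /(_ l' li')/andP[x1 x2]] := cx.
      have /andP[p1 p2] := pc l' li'; rewrite ler_norml.
      by rewrite -natr1 mulrDl mul1r in x2 p2; lra.
    by rewrite ler_norml => /andP[? ?]; apply/andP; split; lra.
  by have [_ /(_ l li)/andP[? ?]] := cx; apply/andP; split; lra.
pose W l := if l == i then 2 * C * h else h.
have volE f : vol (lo f) (hi f) = if f \in family P then \prod_l W l else 0.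
  case: ifP => fP; last by rewrite /vol (bigD1 i) //= !mxE fP subrr mul0r.
  apply: eq_bigr => l _; rewrite !mxE fP /W; case: ifP => _; first by ring.
  by rewrite -natr1; ring.
apply: le_trans VK; apply: (@le_trans _ _ (\sum_f vol (lo f) (hi f))).
  rewrite -[leRHS]big_enum /=; apply: ler_sum_subseq_uniq; rewrite ?enum_uniq // => f.
    by move=> _; rewrite mem_enum.
  exact: vol_ge0.
under eq_bigr do rewrite volE.
rewrite -big_mkcond /= -(bigA_distr_big_dep P (fun l _ => W l)) /=.
rewrite (bigD1 i) //= {1}/P {1}/W eqxx big_pred1_eq.
rewrite (eq_bigr (fun=> 2 * rho)) => [|l /negPf li]; last first.
  rewrite /P /W li sumr_const card_ord -(mulr_natl h) /h.
  by move: K.+1%:R K1 => k k0; field.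
rewrite prodr_const cardC1 card_ord /V /h le_eqVlt; apply/orP; left; apply/eqP.
by move: K.+1%:R K1 => k k0; field.
Qed.


(** Near a point where the i-th partial derivative of g is not zero, the zero set of g is a
    Lipschitz graph over the other coordinates. *)
Lemma zero_set_lipschitz (g : {mpoly R[N]}) (i : 'I_N) (a : 'rV[R]_N) :
  g^`M(i).@[a ord0] != 0 -> exists2 C : R, 0 <= C &
  exists2 U : set 'rV[R]_N, nbhs a U & forall x y, U x -> U y ->
    g.@[x ord0] = 0 -> g.@[y ord0] = 0 ->
    forall d, 0 <= d -> (forall l, l != i -> `|x ord0 l - y ord0 l| <= d) ->
      `|x ord0 i - y ord0 i| <= C * d.
Proof.
have [q [qE qc qd]] := mpoly_slope g; rewrite -qd => qi0.
have m0 : 0 < `|q i (a, a)| by rewrite normr_gt0.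
set m := `|q i (a, a)| in m0.
pose B := \sum_l (`|q l (a, a)| + 1).
have B0 : 0 <= B by apply: sumr_ge0 => l _; apply: addr_ge0.
have : \forall xy \near (a, a), m / 2 < `|q i xy| /\ forall l, `|q l xy| <= B.
  apply: filterI.
    have := qc i (a, a) => /cvgr_norm_gt; apply.
    by rewrite -/m ltr_pdivrMr // ltr_pMr // ltr1n.
  have FF : Filter (nbhs (a, a)) by exact: nbhs_filter.
  apply: (filter_forall (F := nbhs (a, a)) (f := fun l xy => `|q l xy| <= B)) => l.
  have := qc l (a, a) => /cvgr_norm_le; apply.
  rewrite /B (bigD1 l) //=.
  rewrite -addrA ltrDl ltr_wpDr //; by apply: sumr_ge0 => k _; apply: addr_ge0.
case=> -[X Y] /= [aX aY] XY.
exists (N%:R * B / (m / 2)); first by rewrite !mulr_ge0 // invr_ge0 divr_ge0 // ltW.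
exists (X `&` Y); first exact: filterI.
move=> x y [Xx Yx] [Xy Yy] gx gy d d0 xyd.
have [/= qm qB] := XY (x, y) (conj Xx Yy).
have := qE x y; rewrite gx gy subrr (bigD1 i) //= => /esym/eqP.
rewrite addr_eq0 => /eqP /(congr1 Num.norm); rewrite normrN normrM => E.
have m20 : 0 < m / 2 by rewrite divr_gt0.
rewrite mulrAC ler_pdivlMr // mulrC.
apply: (@le_trans _ _ (`|q i (x, y)| * `|x ord0 i - y ord0 i|)).
  by rewrite ler_wpM2r // ltW.
rewrite E; apply: le_trans (ler_norm_sum _ _ _) _.
apply: (@le_trans _ _ (\sum_(l < N) B * d)).
  rewrite [leRHS](bigD1 i) //= ler_wpDl ?mulr_ge0 //.
  by apply: ler_sum => l li; rewrite normrM ler_pM // xyd.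
by rewrite sumr_const card_ord -mulrA mulr_natl.
Qed.

(** By induction on the degree: where d_i g vanishes, the induction hypothesis applies;
    elsewhere the zero set is covered by countably many rational cubes, in each of which it
    is a Lipschitz graph. *)
Lemma measure_zero_zeros (g : {mpoly R[N]}) :
  g != 0 -> measure_zero [set x : 'rV[R]_N | g.@[x ord0] = 0].
Proof.
have [k] := ubnP (msize g); elim: k g => // k IH g; rewrite ltnS => gk g0.
have [|/existsNP[i di]] := pselect (forall i, g^`M(i) = 0).
  move=> /mderiv_all0 gC; apply: (@measure_zero_sub _ set0).
    move=> x /=; rewrite gC mevalC => gz; move: g0; rewrite gC gz mpolyC0.
    by rewrite eqxx.
  have E : set0 = \bigcup_(t : void) (fun _ : void => @set0 'rV[R]_N) t.
    by apply/seteqP; split=> // x [].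
  by rewrite E; apply: measure_zero_bigcup => -[].
move/eqP in di.
pose cube (p : nat * {ffun 'I_N -> rat}) : set 'rV[R]_N :=
  [set x | forall l, `|x ord0 l - ratr (p.2 l)| <= p.1.+1%:R^-1].
pose lip (C : R) (X : set 'rV[R]_N) := forall x y : 'rV[R]_N, X x -> X y ->
  forall d, 0 <= d -> (forall l, l != i -> `|x ord0 l - y ord0 l| <= d) ->
    `|x ord0 i - y ord0 i| <= C * d.
pose A p : set 'rV[R]_N := [set x | cube p x /\ g.@[x ord0] = 0].
pose A' (t : option (nat * {ffun 'I_N -> rat})) : set 'rV[R]_N :=
  if t is Some p then [set x | A p x /\ exists2 C, 0 <= C & lip C (A p)]
  else [set x | g^`M(i).@[x ord0] = 0].
apply: (@measure_zero_sub _ (\bigcup_t A' t)); last first.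
  apply: measure_zero_bigcup => -[p|] /=; last first.
    by apply: IH di; apply: leq_trans (msize_mderiv_lt _ g0) gk.
  have [[C C0 lC]|nC] := pselect (exists2 C, 0 <= C & lip C (A p)).
    apply: (@measure_zero_graph _ (\row_l ratr (p.2 l)) p.1.+1%:R^-1 C i) => //.
      by move=> x [[cx _] _] l; rewrite mxE; apply: cx.
    by move=> x y [Ax _] [Ay _]; apply: lC.
  apply: (@measure_zero_graph _ 0 0 0 i) => //.
    by move=> x [_ /nC].
  by move=> x y [_ /nC].
move=> a /= ga; have [da|da] := eqVneq g^`M(i).@[a ord0] 0; first by exists None.
have [C C0 [U /nbhs_ballP[r /= r0 rU] Ulip]] := zero_set_lipschitz da.
(* A rational cube of radius rho < r / 2 containing a lies in the ball of radius r. *)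
have [k' kr] : exists k' : nat, k'.+1%:R^-1 < r / 2.
  have [|k'] := @ltr_add_invr R 0 (r / 2); first by rewrite divr_gt0.
  by rewrite add0r; exists k'.
have rho0 : 0 < (k'.+1%:R^-1 : R) by rewrite invr_gt0.
have [rho rhoE] : exists rho : R, rho = k'.+1%:R^-1 by exists k'.+1%:R^-1.
rewrite -rhoE in kr rho0.
have /choice[q Hq] : forall l, exists q : rat, `|a ord0 l - ratr q| <= rho.
  move=> l; have [|q] := @rat_in_itvoo R (a ord0 l - rho) (a ord0 l + rho).
    by lra.
  rewrite in_itv /= => /andP[q1 q2]; exists q; rewrite ler_norml; apply/andP; split; lra.
pose p := (k', [ffun l => q l]).
have cubeU x : cube p x -> U x.
  move=> cx; apply: rU; rewrite -ball_normE /=.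
  apply: (@le_lt_trans _ _ (rho + rho)); last by lra.
  rewrite [leLHS]/Num.Def.normr /= mx_normrE; apply/bigmax_leP; split=> [|[o l] _ /=].
    by rewrite addr_ge0 // ltW.
  rewrite !mxE !ord1; have := cx l; have := Hq l; rewrite /= ffunE -rhoE !ler_norml.
  by move=> /andP[? ?] /andP[? ?]; apply/andP; split; lra.
exists (Some p) => //=; split; first by split=> // l; rewrite ffunE -rhoE; exact: Hq.
exists C => // x y [cx gx] [cy gy]; apply: Ulip => //; exact: cubeU.
Qed.

End NullSets.

Section UnitCube.
Variable R : realType.

(** Countably many boxes that cover the unit cube have total volume at least 1. The mask m
    selects the boxes in use: by Fubini, it is enough to integrate over t the inequality for
    the boxes that meet the hyperplane where the first coordinate is t. *)
Lemma unit_cube_cover (N : nat) (m : nat -> bool) (lo hi : nat -> 'I_N -> R) :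
  (forall k i, lo k i <= hi k i) ->
  (forall x : 'I_N -> R, (forall i, 0 <= x i <= 1) ->
     exists2 k, m k & forall i, lo k i <= x i <= hi k i) ->
  (1 <= \sum_(k <oo) ((m k)%:R * \prod_i (hi k i - lo k i))%:E)%E.
Proof.
elim: N m lo hi => [|N IH] m lo hi lohi cov.
  have [|k mk _] := cov (fun=> 0); first by case.
  apply: (@le_trans _ _
    (\sum_(0 <= i < k.+1) ((m i)%:R * \prod_(l < 0) (hi i l - lo i l))%:E)%E).
    rewrite big_nat_recr //= big_ord0 mk mulr1 leeDr //.
    by apply: sume_ge0 => i _; rewrite big_ord0 mulr1 lee_fin.
  by apply: nneseries_lim_ge => i _ _; rewrite big_ord0 mulr1 lee_fin.
pose v k : R := (m k)%:R * \prod_i (hi k (lift ord0 i) - lo k (lift ord0 i)).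
have v0 k : 0 <= v k.
  by rewrite mulr_ge0 // prodr_ge0 // => i _; rewrite subr_ge0.
pose I k : set R := `[lo k ord0, hi k ord0]%classic.
pose D : set R := `[0, 1]%classic.
have mD : measurable D by exact: measurable_itv.
have mI k : measurable (I k) by exact: measurable_itv.
pose f k (t : R) : \bar R := ((v k)%:E * (\1_(I k) t)%:E)%E.
have f0 k t : (0 <= f k t)%E by rewrite /f -EFinM lee_fin mulr_ge0.
have mf k : measurable_fun D (f k).
  apply: measurable_funeM; apply/measurable_EFinP; exact: measurable_indic.
have f1 t : D t -> (1 <= \sum_(k <oo) f k t)%E.
  rewrite /D /= in_itv /= => t01.
  have := IH (fun k => m k && (t \in I k)) (fun k i => lo k (lift ord0 i))
    (fun k i => hi k (lift ord0 i)) _ _.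
  rewrite (eq_eseriesr (g := f^~ t)); first last.
    move=> k _; rewrite /f -EFinM /v indicE -mulnb natrM /=; congr (_%:E); ring.
  apply=> [k i|x x01]; first exact: lohi.
  have [|k mk Hk] := cov (fun i => oapp x t (unlift ord0 i)).
    by move=> i; case: (unlift ord0 i) => [j|] /=; [exact: x01 | exact: t01].
  exists k; last by move=> i; have := Hk (lift ord0 i); rewrite liftK.
  rewrite mk /=; apply/mem_set; rewrite /I /= in_itv /=.
  by have := Hk ord0; rewrite unlift_none.
have int1 : (\int[@lebesgue_measure R]_(t in D) 1%E = 1)%E.
  rewrite integral_cst // mul1e.
  transitivity (lebesgue_measure D) => //.
  by rewrite lebesgue_measure_itv /= lte_fin ltr01 sube0.
rewrite -{1}int1.
apply: (@le_trans _ _ (\int[@lebesgue_measure R]_(t in D) (\sum_(k <oo) f k t))%E).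
  apply: ge0_le_integral => //.
    apply: ge0_emeasurable_sum => // k _; exact: mf.
rewrite integral_nneseries //.
apply: lee_nneseries => [k _ _|k _].
  by apply: integral_ge0.
have mi : measurable_fun D (fun t => (\1_(I k) t)%:E : \bar R).
  by apply/measurable_EFinP; exact: measurable_indic.
rewrite /f ge0_integralZl_EFin //.
rewrite integral_indic; [|exact: mD|exact: mI].
rewrite big_ord_recl.
apply: (@le_trans _ _ ((v k)%:E * lebesgue_measure (I k))%E).
  apply: lee_wpmul2l; first by rewrite lee_fin.
  apply: le_measure; rewrite ?inE; [|exact: mI|exact: subIsetl].
  by apply: measurableI; [exact: mI|exact: mD].
rewrite /I lebesgue_measure_itv /= lte_fin.
case: ifPn => [_|]; first by rewrite -EFinB -EFinM lee_fin /v mulrCA mulrC mulrA.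
rewrite mule0 lee_fin mulr_ge0 // mulr_ge0 ?subr_ge0 // prodr_ge0 // => i _.
by rewrite subr_ge0.
Qed.

Lemma setT_not_measure_zero (N : nat) : ~ measure_zero [set: 'rV[R]_N].
Proof.
move=> /(_ 2^-1); rewrite invr_gt0 ltr0n => /(_ isT)[lo [hi [lohi cov sm]]].
have cov' (x : 'I_N -> R) : (forall i, 0 <= x i <= 1) ->
    exists2 k, true & forall i, lo k ord0 i <= x i <= hi k ord0 i.
  have [|k kx] := cov (\row_i x i); first by [].
  by exists k => // i; have := kx i; rewrite mxE.
have /le_trans := unit_cube_cover lohi cov'.
move=> /(_ (2^-1)%:E); rewrite lee_fin invf_ge1 ?ltr0n // lern1 /=.
suff H : (\sum_(k <oo) (true%:R * \prod_i (hi k ord0 i - lo k ord0 i))%:E <= (2^-1 : R)%:E)%E.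
  by move/(_ H).
apply: lime_le => [|//].
  apply: is_cvg_nneseries => k _ _; rewrite lee_fin mul1r.
  by apply: prodr_ge0 => i _; rewrite subr_ge0.
apply: nearW => k; rewrite sumEFin lee_fin big_mkord.
by under eq_bigr do rewrite mul1r.
Qed.

End UnitCube.

(** * Local injectivity and algebraic independence *)

Lemma poly_roots_seq (R : idomainType) (p : {poly R}) : p != 0 ->
  exists rs : seq R, forall t, root p t -> t \in rs.
Proof.
have [k] := ubnP (size p); elim: k p => // k IH p; rewrite ltnS => pk p0.
have [[t /factor_theorem[q pE]]|nr] := pselect (exists t, root p t); last first.
  by exists [::] => t pt; case: nr; exists t.
have q0 : q != 0 by apply: contraNneq p0 => q0; rewrite pE q0 mul0r.
have [|//|rs Hrs] := IH q.
  by apply: leq_trans pk; rewrite pE size_Mmonic ?monicXsubC // size_XsubC addn2.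
exists (t :: rs) => s; rewrite pE rootM root_XsubC inE => /orP[/Hrs ->|->//].
by rewrite orbT.
Qed.

Section LocalInjectivity.
Variables (R : realType) (N : nat).

(** A nonzero polynomial vanishes on no neighbourhood. *)
Lemma nbhs_meval_neq0 (a : 'rV[R]_N) (U : set 'rV[R]_N) (g : {mpoly R[N]}) :
  nbhs a U -> g != 0 -> exists2 x, U x & g.@[x ord0] != 0.
Proof.
move=> /nbhs_ballP[r /= r0 rU] /meval_neq0[v gv].
pose w : 'rV[R]_N := \row_l v l - a.
pose q := line_restr (a ord0) (w ord0) g.
have q0 : q != 0.
  apply: contraNneq gv => q0; have := congr1 (fun p => p.[1]) q0.
  rewrite horner0 horner_line_restr => <-; apply/eqP/meval_eq => l.
  by rewrite !mxE mulr1; ring.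
apply: contrapT => nU.
pose d := r / (`|w| + 1).
have w1 : 0 < `|w| + 1 by rewrite ltr_wpDl.
have d0 : 0 < d by rewrite divr_gt0.
(* The restriction q of g to the line through a and v would vanish at the points
   d / (i + 1), which are too many. *)
pose s := [seq d / (i.+1)%:R | i <- iota 0 (size q)].
have us : uniq s.
  rewrite map_inj_uniq ?iota_uniq // => i i' /(mulfI (lt0r_neq0 d0))/invr_inj/eqP.
  by rewrite eqr_nat => /eqP[].
have /(max_poly_roots q0) : all (root q) s.
  apply/allP => _ /mapP[i _ ->]; set t := d / _; apply: contrapT => qt.
  apply: nU; exists (a + t *: w); last first.
    move: qt; rewrite rootE horner_line_restr => /negP; apply: contra => /eqP <-.
    by apply/eqP/meval_eq => l; rewrite !mxE mulrC.
  apply: rU; rewrite -ball_normE /= opprD addNKr normrN normrZ.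
  have t0 : 0 <= t by rewrite divr_ge0 // ltW.
  rewrite ger0_norm //; apply: (@le_lt_trans _ _ (d * `|w|)).
    by rewrite ler_wpM2r // ler_piMr ?(ltW d0) // invf_le1 // ler1n.
  rewrite /d -mulrA gtr_pMr // mulrC ltr_pdivrMr // mul1r.
  by rewrite ltrDl.
by rewrite us size_map size_iota ltnn => /(_ isT).
Qed.

Lemma algindep_locally_injective (f : 'I_N -> {mpoly R[N]}) : (0 < N)%N ->
  algindep f -> exists2 Z : set 'rV[R]_N, measure_zero Z &
    forall a, ~ Z a -> exists2 U : set 'rV[R]_N, nbhs a U &
      forall x y, U x -> U y -> (forall i, (f i).@[x ord0] = (f i).@[y ord0]) -> x = y.
Proof.
move=> N0 fi; have [F [e [v [ei eF dF]]]] := jac_extension fi.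
pose g := \det (jac F).
have gE x : g.@[x] = \det (jac_at F x) by rewrite /g -det_map_mx.
exists [set x | g.@[x ord0] = 0].
  apply: measure_zero_zeros => //; apply: contraNneq dF => g0.
  by rewrite -gE g0 meval0.
move=> a /= /eqP; rewrite gE => /mpoly_locally_injective[U aU Uinj].
exists U => // x y Ux Uy fxy; apply: Uinj => // l.
by rewrite -(f_invF ei l) eF fxy.
Qed.

Lemma algindep0 (f : 'I_0 -> {mpoly R[N]}) : algindep f.
Proof.
move=> G; rewrite [G]mderiv_all0; last by case.
by rewrite pcompC => /eqP; rewrite mpolyC_eq0 => /eqP ->; rewrite mpolyC0.
Qed.

Variables (K : nat) (c : 'I_K -> {mpoly R[N]}).

Lemma algindep_maximal : exists (s : nat) (o : 'I_s -> 'I_K),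
  algindep (fun i => c (o i)) /\
  forall k, ~ algindep (fcons (c k) (fun i => c (o i))).
Proof.
apply: contrapT => H.
have : forall s, exists o : 'I_s -> 'I_K, algindep (fun i => c (o i)).
  elim=> [|s [o oi]].
    by exists (fun i : 'I_0 => False_rect _ (notF (ltn_ord i))); exact: algindep0.
  have /existsNP[k /contrapT ki] : ~ forall k, ~ algindep (fcons (c k) (fun i => c (o i))).
    by move=> nk; apply: H; exists s, o.
  exists (fun i => oapp o k (unlift ord0 i)) => G.
  rewrite (eq_pcomp (g := fcons (c k) (fun i => c (o i)))); first exact: ki.
  move=> i; case: (unliftP ord0 i) => [l ->|->];
    by rewrite ?fconsS ?fcons0 ?liftK ?unlift_none.
by move=> /(_ N.+1)[o /algindep_leq]; rewrite ltnn.
Qed.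

(** If fewer than N of the c_k are independent, the map c is not injective on any neighbourhood:
    see the argument about fibres above. *)
Lemma locally_injective_algindep (a : 'rV[R]_N) (U : set 'rV[R]_N) :
  nbhs a U ->
  (forall x y, U x -> U y -> (forall k, (c k).@[x ord0] = (c k).@[y ord0]) -> x = y) ->
  exists o : 'I_N -> 'I_K, algindep (fun i => c (o i)).
Proof.
move=> aU Uinj; have [s [o [fi nk]]] := algindep_maximal.
have := algindep_leq fi; rewrite leq_eqVlt => /orP[/eqP sN|sN].
  by subst s; exists o.
exfalso.
set f := fun i => c (o i) in fi nk.
have /choice[G HG] : forall k, exists G, pcomp (fcons (c k) f) G = 0 /\
    pcomp (fcons (c k) f) G^`M(ord0) != 0.
  by move=> k; have [G] := algdep_simple fi (nk k); exists G.
pose h k := pcomp (fcons (c k) f) (G k)^`M(ord0).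
have [F [e [v [ei eF dF]]]] := jac_extension fi.
pose g := \det (jac F) * \prod_k h k.
have g0 : g != 0.
  rewrite mulf_neq0 //.
    apply: contraNneq dF => d0; rewrite /jac_at det_map_mx d0.
    by rewrite /= meval0.
  by apply/prodf_neq0 => k _; have [] := HG k.
have [b bU] := nbhs_meval_neq0 (nbhs_interior aU) g0.
rewrite mevalM mulf_eq0 negb_or -det_map_mx rmorph_prod => /andP[dFb /prodf_neq0 hb].
have [eps eps0 Hopen] := mpoly_locally_open dFb bU.
(* The coordinate l of F is not in f: moving it stays in the fibre of f. *)
have [l le] : exists l, forall i, e i != l.
  have /subsetPn[l _ lN] : ~~ ([set: 'I_N]%SET \subset [set e i | i in 'I_s]%SET).
    apply/negP => /subset_leq_card; rewrite cardsT card_imset // !card_ord.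
    by rewrite leqNgt sN.
  by exists l => i; apply: contraNneq lN => <-; apply/imsetP; exists i.
pose wt (m : nat) : 'rV[R]_N := \row_i ((F i).@[b ord0] + (i == l)%:R * (eps / m.+1%:R)).
have /choice[x Hx] : forall m, exists x, U x /\ forall i, (F i).@[x ord0] = wt m ord0 i.
  move=> m; have [|x Ux xE] := Hopen (wt m); last first.
    by exists x; split=> //; exact: interior_subset.
  rewrite [leLHS]/Num.Def.normr /= mx_normrE; apply/bigmax_leP; split=> [|[i0 i] _ /=].
    exact: ltW.
  rewrite !mxE opprD addNKr normrN normrM.
  have e1 : `|eps / m.+1%:R| <= eps.
    rewrite ger0_norm; last by rewrite divr_ge0 // ltW.
    by rewrite ler_piMr ?(ltW eps0) // invf_le1 // ler1n.
  by case: eqP => _; rewrite ?normr1 ?normr0 ?mul1r ?mul0r // ltW.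
have xinj m m' : x m = x m' -> m = m'.
  move=> xx; have [_ /(_ l)] := Hx m; rewrite xx; have [_ /(_ l) ->] := Hx m'.
  rewrite !mxE eqxx !mul1r => /addrI/(mulfI (lt0r_neq0 eps0))/invr_inj/eqP.
  by rewrite eqr_nat => /eqP[].
have fx m i : (f i).@[x m ord0] = (f i).@[b ord0].
  have [_ /(_ (e i))] := Hx m; rewrite mxE (negPf (le i)) mul0r addr0.
  by rewrite !eF.
(* The relation G_k at the values f (b), as a univariate polynomial: c_k (x m) is a
   root of it, and it is not 0 because c_k (b) is a simple root. *)
pose Q k := line_restr (fun i => oapp (fun i => (f i).@[b ord0]) 0 (unlift ord0 i))
  (fun i => (i == ord0)%:R) (G k).
have QE (p : {mpoly R[s.+1]}) k y : (forall i, (f i).@[y ord0] = (f i).@[b ord0]) ->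
    (line_restr (fun i => oapp (fun i => (f i).@[b ord0]) 0 (unlift ord0 i))
      (fun i => (i == ord0)%:R) p).[(c k).@[y ord0]] =
    (pcomp (fcons (c k) f) p).@[y ord0].
  move=> fy; rewrite horner_line_restr meval_pcomp; apply: meval_eq => i.
  case: (unliftP ord0 i) => [i' ->|->].
    by rewrite fconsS /= mul0r addr0 fy.
  by rewrite fcons0 /= mul1r add0r.
have Q0 k : Q k != 0.
  apply: contraNneq (hb k isT) => Qk; rewrite /= /h -QE //.
  have := congr1 (fun p => p^`().[(c k).@[b ord0]]) Qk.
  rewrite deriv_line_restr big_ord_recl big1 => [|i _]; last first.
    by rewrite /= polyC0 mulr0.
  by rewrite addr0 eqxx mulr1 deriv0 horner0 => ->.
have /choice[rs Hrs] : forall k, exists rs : seq R, forall m, (c k).@[x m ord0] \in rs.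
  move=> k; have [rs Hrs] := poly_roots_seq (Q0 k); exists rs => m; apply: Hrs.
  have [GE _] := HG k.
  by rewrite rootE /Q QE // GE meval0.
pose D := (\max_k size (rs k)).+1.
have idx_lt k m : (index (c k).@[x m ord0] (rs k) < D)%N.
  by rewrite ltnS; apply: leq_trans (leq_bigmax k); rewrite index_size.
(* The vectors c (x m) take finitely many values, and determine m. *)
pose code (m : nat) : {ffun 'I_K -> 'I_D} := [ffun k => Ordinal (idx_lt k m)].
have code_inj : injective code.
  move=> m m' /ffunP mm; apply: xinj; apply: Uinj => [||k].
  - by have [] := Hx m.
  - by have [] := Hx m'.
  have := congr1 val (mm k); rewrite !ffunE /= => E.
  by rewrite -(nth_index 0 (Hrs k m)) E nth_index.
have cinj : injective (fun m : 'I_(#|{ffun 'I_K -> 'I_D}|.+1) => code m).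
  by move=> m m' /code_inj/val_inj.
by have := leq_card _ cinj; rewrite card_ord ltnn.
Qed.

End LocalInjectivity.

(** * Chains of primes and algebraic independence *)

(** Division by the first variable: F (X) = F (0, X_1, ...) + X_0 H. *)
Lemma mpoly_split0 (R : comNzRingType) (m : nat) (F : {mpoly R[m.+1]}) :
  exists H, F = pcomp (fun i => 'X_(lift ord0 i)) (pcomp (fcons 0 (fun i : 'I_m => 'X_i)) F)
                + 'X_ord0 * H.
Proof.
elim/mpoly_alg_ind: F => [c|k|p q [Hp Ep] [Hq Eq]|p q [Hp Ep] [Hq Eq]].
- by exists 0; rewrite !pcompC mulr0 addr0.
- rewrite pcompX; case: (unliftP ord0 k) => [i ->|->].
    by exists 0; rewrite fconsS pcompX mulr0 addr0.
  by exists 1; rewrite fcons0 rmorph0 add0r mulr1.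
- by exists (Hp + Hq); rewrite !rmorphD /= {1}Ep {1}Eq mulrDr addrACA.
- rewrite !rmorphM /=; move: (pcomp _ (pcomp _ p)) (pcomp _ (pcomp _ q)) Ep Eq => a b -> ->.
  by exists (Hp * b + a * Hq + 'X_ord0 * Hp * Hq); ring.
Qed.

Section Chains.
Variables (R : realType) (k : nat).
Implicit Types (P : nat -> {pred {mpoly R[k]}}).

(** Elements q_i of P_(i+1) that are not in P_i are independent modulo P_0: in a relation
    G, setting q_0 = 0 gives a relation modulo P_1, which is trivial by induction on e, so
    that X_0 divides G; as q_0 is not in the prime P_0, the quotient is also a relation. *)
Lemma prime_chain_indep (e : nat) P :
  (forall i, (i <= e)%N -> prime_ideal (P i)) ->
  (forall i, (i < e)%N -> {subset P i <= P i.+1} /\ ~ {subset P i.+1 <= P i}) ->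
  exists g : 'I_e -> {mpoly R[k]}, forall G, pcomp g G \in P 0%N -> G = 0.
Proof.
elim: e P => [|e IH] P Pp Ps.
  exists (fun=> 0) => G; rewrite [G]mderiv_all0; last by case.
  rewrite pcompC => H; have [[_ P1 PD] _] := Pp 0%N isT.
  have [->|c0] := eqVneq G@_0 0; first exact: mpolyC0.
  have P0 : 0 \in P 0%N by have [[]] := Pp 0%N isT.
  case/negP: P1; have := PD ((G@_0)^-1)%:MP _ _ H P0.
  by rewrite addr0 -mpolyCM mulVf // mpolyC1.
have [||g' Hg'] := IH (fun i => P i.+1).
- by move=> i; exact: (Pp i.+1).
- by move=> i; exact: (Ps i.+1).
have [P01 /existsNP[q /not_implyP[qP1 qP0]]] := Ps 0%N isT.
have [[_ _ PD] _] := Pp 1%N isT; have [_ Pprime] := Pp 0%N isT.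
exists (fcons q g') => G; have [s] := ubnP (msize G); elim: s G => // s IHs G.
rewrite ltnS => Gs GP; have [//|G0] := eqVneq G 0.
have [H GE] := mpoly_split0 G; set F0 := pcomp (fcons 0 _) G in GE.
have gE : pcomp (fcons q g') G = pcomp g' F0 + q * pcomp (fcons q g') H.
  rewrite {1}GE rmorphD rmorphM /= pcompX fcons0; congr (_ + _).
  by rewrite pcomp_pcomp; apply: eq_pcomp => i; rewrite pcompX fconsS.
have F00 : F0 = 0.
  apply: Hg'; have -> : pcomp g' F0 = (- pcomp (fcons q g') H) * q + pcomp (fcons q g') G.
    by rewrite gE mulNr mulrC; ring.
  exact: PD (P01 _ GP).
rewrite F00 rmorph0 add0r in GE; rewrite F00 rmorph0 add0r in gE.
have H0 : H != 0 by apply: contraNneq G0 => H0; rewrite GE H0 mulr0.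
case/eqP: (H0); apply: IHs.
  apply: leq_trans Gs; rewrite GE msizeM ?H0 //; last first.
    by rewrite -msize_poly_eq0 msizeX.
  by rewrite msizeX mdeg1.
have := Pprime q (pcomp (fcons q g') H).
by rewrite -gE => /(_ GP)/orP[|//]; move/negP: qP0 => /negPf ->.
Qed.

End Chains.

Section RangeDimension.
Variables (R : realType) (N k : nat) (c : 'I_k -> {mpoly R[N]}).
Variable S : set 'rV[R]_k.
Hypothesis SE : S = range (fun a : 'rV[R]_N => \row_i (c i).@[a ord0]).

Lemma vanishing_pcomp p : vanishing_ideal S p <-> pcomp c p = 0.
Proof.
split=> [H|H].
  apply: meval_all0 => v; rewrite meval_pcomp.
  have /H <- : S (\row_i (c i).@[v]).
    rewrite SE; exists (\row_i v i) => //; apply/rowP => i; rewrite !mxE.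
    by apply: meval_eq => l; rewrite mxE.
  by apply: meval_eq => i; rewrite mxE.
move=> y; rewrite SE => -[a _ <-]; have := congr1 (meval (a ord0)) H.
by rewrite meval_pcomp meval0 => <-; apply: meval_eq => i; rewrite mxE.
Qed.

(** The composition with c maps R[y] / I(S) injectively to R[x], so that a chain gives
    independent polynomials in the coefficients. *)
Lemma chain_algindep e : has_prime_chain S e ->
  exists g : 'I_e -> {mpoly R[k]}, algindep (fun i => pcomp c (g i)).
Proof.
case=> P [Pp PS Ps]; have [g Hg] := prime_chain_indep Pp Ps.
exists g => G GE; apply: Hg; apply: PS; apply/vanishing_pcomp.
by rewrite pcomp_pcomp.
Qed.

(** The i-th prime is the kernel of the restriction of p (c) to an affine subspace of
    dimension d - i on which f = c o has Jacobian rank d - i. The inclusions are strict,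
    because d - i of the f_a are independent on this subspace, but are not on the next one. *)
Lemma algindep_chain d (o : 'I_d -> 'I_k) :
  algindep (fun i => c (o i)) -> has_prime_chain S d.
Proof.
move=> fi; have [F [e [v [ei eF dF]]]] := jac_extension fi.
pose C : 'M[R]_(N, d) := colsub e (invmx (jac_at F v)).
have JC i b : \sum_l (c (o i))^`M(l).@[v] * C l b = (i == b)%:R.
  have := congr1 (fun A : 'M_N => A (e i) (e b)) (mulmxV (_ : jac_at F v \in unitmx)).
  rewrite unitmxE unitfE dF => /(_ isT); rewrite !mxE (inj_eq ei) => <-.
  by apply: eq_bigr => l _; rewrite !mxE eF.
(* C is a right inverse of the Jacobian matrix of f at v; its columns direct the
   affine subspaces, and Cn extends them by 0. *)
pose Cn l (b : nat) : R := oapp (C l) 0 (insub b).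
pose line t (l : 'I_N) : {mpoly R[t]} := (v l)%:MP + \sum_(b < t) Cn l b *: 'X_b.
pose Q t := pcomp (fun i => pcomp (line t) (c i)).
have lineE t l x : (line t l).@[x] = v l + \sum_(b < t) Cn l b * x b.
  rewrite mevalD mevalC; congr (_ + _).
  rewrite [LHS]raddf_sum; apply: eq_bigr => b _.
  by rewrite /= mevalZ mevalXU.
have dline t l b : (line t l)^`M(b) = (Cn l b)%:MP.
  rewrite mderivD mderivC add0r raddf_sum (bigD1 b) //= big1 => [|b' bb'].
    rewrite addr0 mderivZ mderivX mnm1E eqxx scale1r -[X in (X - _)%MM]add0m.
    by rewrite addmK mpolyX0 -mul_mpolyC mulr1.
  by rewrite mderivZ mderivX mnm1E (negPf bb') scale0r scaler0.
pose K i : {pred {mpoly R[k]}} := fun p => Q (d - i)%N p == 0.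
have KE i p : (p \in K i) = (Q (d - i)%N p == 0) by [].
exists K; split=> [i _|p|i id].
- split; last first.
    by move=> p q; rewrite !KE /Q rmorphM mulf_eq0.
  split=> [||a p q]; rewrite ?KE /Q ?rmorph0 ?rmorph1 ?oner_eq0 //.
  by rewrite ?KE /Q rmorphD rmorphM /= => /eqP -> /eqP ->; rewrite mulr0 addr0.
- by move/vanishing_pcomp => H; rewrite KE /Q -pcomp_pcomp H rmorph0.
have [t tE] : exists t, (d - i)%N = t.+1 by exists (d - i).-1; rewrite prednK // subn_gt0.
have tE' : (d - i.+1)%N = t by rewrite subnS tE.
have td : (t.+1 <= d)%N by rewrite -tE leq_subr.
split=> [p|sub].
  rewrite !KE tE tE' => /eqP H; apply/eqP; apply: meval_all0 => x.
  have := congr1 (meval (fun b : 'I_t.+1 => oapp x 0 (insub (b : nat)))) H.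
  rewrite meval0 !meval_pcomp => <-; apply: meval_eq => q; rewrite !meval_pcomp.
  apply: meval_eq => l; rewrite !lineE big_ord_recr /= insubF ?ltnn // mulr0 addr0.
  by congr (_ + _); apply: eq_bigr => b _; rewrite valK.
pose wd (a : 'I_t.+1) := widen_ord td a.
pose H u (a : 'I_t.+1) : {mpoly R[u]} := pcomp (line u) (c (o (wd a))).
have HE u G : pcomp (H u) G = Q u (pcomp (fun a => 'X_(o (wd a))) G).
  by rewrite /Q pcomp_pcomp; apply: eq_pcomp => a; rewrite pcompX.
have [G G0 GE] := @algdep_many _ _ _ (H t) (ltnSn t).
(* At the origin, the Jacobian matrix of the restricted f_a is the identity. *)
have Hi : algindep (H t.+1).
  apply: (@jac_free_algindep _ _ _ _ (fun=> 0)).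
  suff -> : jac_at (H t.+1) (fun=> 0) = 1%:M by rewrite row_free_unit unitmx1.
  apply/matrixP => a b; rewrite jac_atE mderiv_pcomp [LHS]raddf_sum !mxE.
  rewrite (_ : (a == b) = (wd a == wd b)) // -JC; apply: eq_bigr => l _.
  rewrite /= dline mevalM mevalC meval_pcomp; congr (_ * _).
    by apply: meval_eq => l'; rewrite lineE big1 ?addr0 // => b' _; rewrite mulr0.
  rewrite /Cn; case: insubP => [b' _ bE|]; first by congr (C l _); exact: val_inj.
  by rewrite (leq_trans (ltn_ord b) td).
move/eqP: G0; apply; apply: Hi; rewrite HE; apply/eqP.
have := sub (pcomp (fun a => 'X_(o (wd a))) G); rewrite !KE tE tE' -!HE GE eqxx.
exact.
Qed.

End RangeDimension.

(** * Coefficients of the input-output equation *)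

Section DiagConj.
Variables (F : fieldType) (n : nat) (d : 'I_n -> F).
Hypothesis d0 : forall i, d i != 0.

(** The conjugate of A by the diagonal matrix with diagonal d. *)
Definition dconj (A : 'M[F]_n) : 'M[F]_n := \matrix_(k, i) (d k * A k i / d i).

Let Dl : 'M[{poly F}]_n := diag_mx (\row_i (d i)%:P).
Let Dr : 'M[{poly F}]_n := diag_mx (\row_i (d i)^-1%:P).

Let DlDr : Dl *m Dr = 1%:M.
Proof.
rewrite mulmx_diag; apply/matrixP => i k; rewrite !mxE.
by rewrite -polyCM divff ?d0.
Qed.

Let DrDl : Dr *m Dl = 1%:M.
Proof. exact: mulmx1C DlDr. Qed.

Lemma char_poly_mx_dconj A : char_poly_mx (dconj A) = Dl *m char_poly_mx A *m Dr.
Proof.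
rewrite /char_poly_mx mulmxBr mulmxBl mul_mx_scalar -scalemxAl DlDr scalemx1.
congr (_ - _); apply/matrixP => k i; rewrite mul_diag_mx mul_mx_diag !mxE.
by rewrite !polyCM.
Qed.

Lemma char_poly_dconj A : char_poly (dconj A) = char_poly A.
Proof.
rewrite /char_poly char_poly_mx_dconj !det_mulmx mulrAC -det_mulmx DlDr det1.
exact: mul1r.
Qed.

Lemma cofactor_dconj A i j : d i = 1 -> d j = 1 ->
  cofactor (char_poly_mx (dconj A)) i j = cofactor (char_poly_mx A) i j.
Proof.
move=> di dj.
pose X := char_poly_mx A; pose X' := char_poly_mx (dconj A).
have E : \adj X' = Dl *m \adj X *m Dr.
  have dX : \det X' = \det X := char_poly_dconj A.
  have : \adj X' *m (X' *m (Dl *m \adj X *m Dr)) = \adj X' *m (\det X)%:M.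
    congr (_ *m _); rewrite /X' char_poly_mx_dconj -!mulmxA (mulmxA Dr) DrDl mul1mx.
    by rewrite (mulmxA X) mul_mx_adj mul_scalar_mx -scalemxAr DlDr scalemx1.
  rewrite mulmxA mul_adj_mx dX mul_scalar_mx mul_mx_scalar => /matrixP H.
  apply/matrixP => a b; have := H a b; rewrite !mxE => /mulfI -> //.
  by apply: monic_neq0; exact: char_poly_monic.
have := congr1 (fun Y : 'M_n => Y j i) E.
by rewrite mul_diag_mx mul_mx_diag !mxE di dj invr1 mulr1 mul1r.
Qed.

End DiagConj.

Section Coefs.
Variables (R : realType) (n : nat) (M : model n) (j : 'I_n).

(** The coefficients of the input-output equation as functions of the compartmental matrix:
    (None, k) stands for the coefficient of degree k of the left-hand side, (Some i, k) for
    that of the factor of u_i on the right-hand side, or for 0 when i is not an input. *)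
Definition coef_fun (o : option 'I_n * nat) (A : 'M[R]_n) : R :=
  if o.1 is Some i then
    if i \in input M then (cofactor (char_poly_mx A) i j)`_o.2 else 0
  else (char_poly A)`_o.2.

(** The same coefficients as polynomials in the parameters. *)
Definition coef_mpoly (o : option 'I_n * nat) : {mpoly R[nparam M]} :=
  if o.1 is Some i then
    if i \in input M then (io_rhs R M j i)`_o.2 else 0
  else (io_lhs R M)`_o.2.

(** The compartmental matrix at the parameter values a. *)
Definition cmx_at (a : 'I_(nparam M) -> R) : 'M[R]_n :=
  map_mx (meval a) (compartmental_mx R M).

Lemma meval_coef_mpoly a o : (coef_mpoly o).@[a] = coef_fun o (cmx_at a).
Proof.
case: o => [[i|] k]; rewrite /coef_mpoly /coef_fun /=.
  case: ifP => _; last by rewrite meval0.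
  by rewrite /cmx_at -map_char_poly_mx cofactor_map_mx coef_map.
by rewrite /cmx_at -map_char_poly coef_map.
Qed.

(** The list [io_coefs] consists of the coefficients other than 0 and 1. *)
Lemma io_coefsP p : reflect ([/\ p != 0, p != 1 & exists o, p = coef_mpoly o])
  (p \in io_coefs R M j).
Proof.
rewrite /io_coefs mem_filter mem_cat; apply: (iffP andP).
  case=> /andP[p0 p1] /orP H; split=> //; case: H => [/(nthP 0)[k _ <-]|].
    by exists (None, k).
  case/flatten_mapP => i; rewrite mem_enum => iI /(nthP 0)[k _ <-].
  by exists (Some i, k); rewrite /coef_mpoly /= iI.
case=> p0 p1 [[[i|] k]] E; rewrite p0 p1; split=> //; apply/orP.
  move: p0 E; rewrite /coef_mpoly /=.
  case: ifP => [iI p0 E|_ p0 E]; last by rewrite E eqxx in p0.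
  right; apply/flatten_mapP; exists i; rewrite ?mem_enum // E mem_nth // ltnNge.
  by apply: contra p0 => H; rewrite E nth_default.
left; rewrite E mem_nth // ltnNge.
by apply: contra p0 => H; rewrite E /coef_mpoly /= nth_default.
Qed.

(** The parameter values with edge labels e i k and leak parameters l i. *)
Definition mkpar (e : 'I_n -> 'I_n -> R) (l : 'I_n -> R) (p : 'I_(nparam M)) : R :=
  match enum_val p with
  | inl ed => e (val ed).2 (val ed).1
  | inr v => l (val v)
  end.

Lemma edge_param_mk e l i k :
  (edge_param R M i k).@[mkpar e l] = if (k, i) \in edges M then e i k else 0.
Proof.
rewrite /edge_param; case: insubP => [u _ /= uE|/negPf ->]; last exact: meval0.
rewrite -uE (valP u) /param_var mevalXU /mkpar enum_rankK /= uE.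
by [].
Qed.

Lemma leak_param_mk e l i :
  (leak_param R M i).@[mkpar e l] = if i \in leak M then l i else 0.
Proof.
rewrite /leak_param; case: insubP => [u _ /= uE|/negPf ->]; last exact: meval0.
by rewrite -uE (valP u) /param_var mevalXU /mkpar enum_rankK.
Qed.

Lemma edge_param_notin a i k : (k, i) \notin edges M -> (edge_param R M i k).@[a] = 0.
Proof. by move=> H; rewrite /edge_param insubN //= meval0. Qed.

Lemma leak_param_notin a i : i \notin leak M -> (leak_param R M i).@[a] = 0.
Proof. by move=> H; rewrite /leak_param insubN //= meval0. Qed.

Lemma cmx_atE a i k : cmx_at a i k =
  if i == k then - (leak_param R M i).@[a] -
    \sum_(l | (i, l) \in edges M) (edge_param R M l i).@[a]
  else (edge_param R M i k).@[a].
Proof.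
rewrite !mxE; case: ifP => // _.
by rewrite mevalB mevalN; congr (_ - _); exact: raddf_sum.
Qed.

End Coefs.

(** * Rescaling the model with a leak everywhere *)

Section MaxPrinciple.
Variables (R : realDomainType) (n : nat) (E : rel 'I_n) (L : {set 'I_n}).
Hypothesis reach : forall v, exists2 w, w \in L & connect E v w.

(** The maximum principle on a graph all of whose vertices are connected to L. *)
Lemma harmonic_le0 (u : 'I_n -> R) :
  (forall i, i \in L -> u i = 0) ->
  (forall i, i \notin L -> \sum_(k | E i k) (u k - u i) = 0) ->
  forall i, u i <= 0.
Proof.
move=> uL uh i.
have [x _ xmax] : exists2 x, true & forall y, u y <= u x.
  by case: (arg_maxP u (erefl : xpredT i)) => x _ H; exists x => // y; exact: H.
apply: le_trans (xmax i) _; rewrite leNgt; apply/negP => ux0.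
have [w wL /connectP[p]] := reach x.
have : u x = u x by []; move: {1 3 4}x => y; elim: p y => [|z p IH] y /= uy.
  by move=> _ wy; move: ux0; rewrite -uy -wy uL // ltxx.
case/andP => yz; apply: IH.
have yL : y \notin L by apply: contraTN ux0 => /uL; rewrite uy => ->; rewrite ltxx.
have /eqP := uh y yL; rewrite -oppr_eq0 -sumrN psumr_eq0 => [/allP|k _].
  move=> /(_ z); rewrite mem_index_enum => /(_ isT); rewrite yz /= opprB subr_eq0.
  by move/eqP <-.
by rewrite opprB subr_ge0 uy.
Qed.

Lemma harmonic_eq0 (u : 'I_n -> R) :
  (forall i, i \in L -> u i = 0) ->
  (forall i, i \notin L -> \sum_(k | E i k) (u k - u i) = 0) ->
  forall i, u i = 0.
Proof.
move=> uL uh i; apply/eqP; rewrite eq_le harmonic_le0 //= -oppr_le0.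
apply: (harmonic_le0 (u := fun i => - u i)) => [k /uL ->|k /uh H]; first exact: oppr0.
rewrite (eq_bigr (fun l => - (u l - u k))) => [|l _]; last by rewrite opprB opprK addrC.
by rewrite sumrN H oppr0.
Qed.

End MaxPrinciple.

Section Transfer.
Variables (R : realType) (n : nat) (M : model n) (j : 'I_n).
Hypothesis hleak : leak M = (input M :|: output M)%SET.
Hypothesis hconn : output_connectable M.
Hypothesis hout : output M = [set j]%SET.

Let M' := leak_everywhere M.
Let L := leak M.

Let inL i : i \in input M -> i \in L.
Proof. by move=> iI; rewrite /L hleak inE iI. Qed.

Let jL : j \in L.
Proof. by rewrite /L hleak hout !inE eqxx orbT. Qed.

(** A matrix of M is a matrix of M~, with zero leak parameters outside L. *)
Lemma cmx_at_extend (a : 'I_(nparam M) -> R) : exists a', cmx_at (M := M') a' = cmx_at a.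
Proof.
exists (mkpar (M := M') (fun i k => (edge_param R M i k).@[a])
  (fun i => (leak_param R M i).@[a])).
have eE i k : (if (k, i) \in edges M then (edge_param R M i k).@[a] else 0) =
    (edge_param R M i k).@[a].
  by case: ifP => // /negbT /edge_param_notin ->.
apply/matrixP => i k; rewrite !cmx_atE; case: ifP => _; last by rewrite edge_param_mk eE.
rewrite leak_param_mk inE; congr (_ - _); apply: eq_bigr => l il.
by rewrite edge_param_mk eE.
Qed.

Lemma cmx_at_offdiag (a : 'I_(nparam M') -> R) i k :
  i != k -> (k, i) \notin edges M -> cmx_at a i k = 0.
Proof. by move=> /negPf ik H; rewrite cmx_atE ik edge_param_notin. Qed.

Lemma colsum_split (A : 'M[R]_n) (d : 'I_n -> R) i :
  (forall k, k != i -> (i, k) \notin edges M -> A k i = 0) ->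
  \sum_k d k * A k i = d i * A i i + \sum_(k | (i, k) \in edges M) d k * A k i.
Proof.
move=> A0; rewrite (bigD1 i) //=; congr (_ + _).
rewrite big_mkcond [RHS]big_mkcond; apply: eq_bigr => k _ /=.
have [->|ki] := eqVneq k i; first by rewrite (negPf (edges_irrefl M i)).
by case: ifP => // /negbT H; rewrite A0 // mulr0.
Qed.

(** Given zero column sums outside L after rescaling by d, the leak parameters on L absorb
    the diagonal entries. *)
Lemma cmx_at_rescale (a : 'I_(nparam M') -> R) (d : 'I_n -> R) :
  (forall i, d i != 0) -> (forall i, i \in L -> d i = 1) ->
  (forall i, i \notin L -> \sum_k d k * cmx_at a k i = 0) ->
  exists b, cmx_at (M := M) b = dconj d (cmx_at a).
Proof.
move=> d0 dL dA; set A' := dconj d (cmx_at a).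
exists (mkpar (M := M) (fun k i => A' k i)
  (fun i => - A' i i - \sum_(k | (i, k) \in edges M) A' k i)).
apply/matrixP => k i; rewrite cmx_atE; case: eqP => [<-{i}|/eqP ki]; last first.
  rewrite edge_param_mk; case: ifPn => // H.
  by rewrite /A' mxE cmx_at_offdiag // mulr0 mul0r.
rewrite leak_param_mk.
under [X in _ - X = _]eq_bigr => l kl do rewrite edge_param_mk kl.
case: ifPn => kL; first by rewrite opprB opprK addrAC subrr add0r.
rewrite oppr0 add0r; apply/esym/eqP; rewrite -addr_eq0.
have := dA k kL.
rewrite (colsum_split (A := cmx_at a)) => [H|l lk]; last exact: cmx_at_offdiag.
under eq_bigr do rewrite mxE.
by rewrite mxE -mulr_suml -mulrDl H mul0r.
Qed.

(* d^T A has entry 0 outside L and d is 1 on L exactly when d^T B is the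
   indicator row of L; up to the factor det B, the solution d is w. *)
Let Bmx : 'M[{mpoly R[nparam M']}]_n :=
  \matrix_(k, i) if i \in L then (k == i)%:R else compartmental_mx R M' k i.

Let w : 'rV[{mpoly R[nparam M']}]_n := (\row_i (i \in L)%:R) *m \adj Bmx.

(* Where Delta is not zero, d is defined and has no zero entry. *)
Let Delta := \det Bmx * \prod_i w 0 i.

(** At the matrix of M with all parameters 1, the column sums outside L are zero, so that
    d = 1; and B is invertible, because a vector in its left kernel is harmonic outside L
    and zero on L. *)
Lemma Delta_neq0 : Delta != 0.
Proof.
pose a := mkpar (M := M') (fun _ _ => 1 : R) (fun i => (i \in L)%:R).
have aE i k : (edge_param R M' i k).@[a] = ((k, i) \in edges M)%:R.
  by rewrite edge_param_mk; case: ifP.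
have offE i k : i != k -> cmx_at a i k = ((k, i) \in edges M)%:R.
  by move=> /negPf ik; rewrite cmx_atE ik aE.
have diagE i : i \notin L -> cmx_at a i i = - \sum_(k | (i, k) \in edges M) 1.
  move=> /negPf iL; rewrite cmx_atE eqxx leak_param_mk inE iL oppr0 add0r.
  by congr (- _); apply: eq_bigr => k ik; rewrite aE ik.
pose B := map_mx (meval a) Bmx.
have BE k i : B k i = if i \in L then (k == i)%:R else cmx_at a k i.
  rewrite /B mxE [Bmx _ _]mxE; case: ifP => _; first by rewrite rmorph_nat.
  by rewrite [RHS]mxE.
have BL (u : 'rV[R]_n) i : i \in L -> (u *m B) 0 i = u 0 i.
  move=> iL; rewrite mxE (bigD1 i) //= BE iL eqxx mulr1 big1 ?addr0 // => k /negPf ki.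
  by rewrite BE iL ki mulr0.
have BnL (u : 'rV[R]_n) i : i \notin L ->
    (u *m B) 0 i = \sum_(k | (i, k) \in edges M) (u 0 k - u 0 i).
  move=> iL; rewrite mxE; under eq_bigr do rewrite BE (negPf iL).
  rewrite colsum_split => [|k ki kn]; last by rewrite offE // (negPf kn).
  rewrite diagE // mulrN mulr_sumr -sumrN -big_split /=; apply: eq_bigr => k ik.
  rewrite offE ?ik ?mulr1 1?addrC // .
  by apply: contraTneq ik => ->; exact: edges_irrefl.
have dB : \det B != 0.
  apply/negP => /det0P[u u0 uB]; move/eqP: u0; apply; apply/rowP => i; rewrite mxE.
  apply: (@harmonic_eq0 _ _ [rel x y | (x, y) \in edges M] L) => [v|k kL|k kL].
  - by have [x xo] := hconn v; exists x => //; rewrite /L hleak inE xo orbT.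
  - by rewrite -BL // uB mxE.
  - by rewrite -BnL // uB mxE.
have oneB : const_mx 1 *m B = \row_i (i \in L)%:R.
  apply/rowP => i; rewrite [RHS]mxE; have [iL|iL] := boolP (i \in L).
    by rewrite BL // mxE.
  by rewrite BnL // big1 // => k _; rewrite !mxE subrr.
have wE : map_mx (meval a) w = (\det B) *: const_mx 1.
  rewrite /w map_mxM map_mx_adj -/B -mul_mx_scalar -mul_mx_adj mulmxA oneB.
  by congr (_ *m _); apply/rowP => i; rewrite !mxE rmorph_nat.
apply: contra_neq (_ : Delta.@[a] != 0); first by move=> ->; rewrite meval0.
rewrite mevalM -det_map_mx -/B mulf_neq0 // rmorph_prod; apply/prodf_neq0 => i _.
have := congr1 (fun u : 'rV_n => u 0 i) wE.
by rewrite /= mxE [RHS]mxE [const_mx _ _ _]mxE mulr1 => ->.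
Qed.

(** The rescaling d is the quotient of w by det B. *)
Lemma Delta_rescale (a : 'I_(nparam M') -> R) : Delta.@[a] != 0 ->
  exists d : 'I_n -> R, [/\ forall i, d i != 0, forall i, i \in L -> d i = 1 &
    forall i, i \notin L -> \sum_k d k * cmx_at a k i = 0].
Proof.
pose B := map_mx (meval a) Bmx; pose v := map_mx (meval a) w.
rewrite mevalM -det_map_mx -/B mulf_eq0 negb_or rmorph_prod => /andP[dB /prodf_neq0 w0].
have BE k i : B k i = if i \in L then (k == i)%:R else cmx_at a k i.
  rewrite /B mxE [Bmx _ _]mxE; case: ifP => _; first by rewrite rmorph_nat.
  by rewrite [RHS]mxE.
have vB : v *m B = (\det B) *: (\row_i (i \in L)%:R).
  rewrite /v /w map_mxM map_mx_adj -/B -mulmxA mul_adj_mx mul_mx_scalar.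
  by congr (_ *: _); apply/rowP => i; rewrite !mxE rmorph_nat.
pose d i := (\det B)^-1 * v 0 i.
have dE i : \sum_k d k * B k i = (i \in L)%:R.
  have := congr1 (fun u : 'rV_n => (\det B)^-1 * u 0 i) vB; rewrite !mxE mulKf // => <-.
  by rewrite mulr_sumr; apply: eq_bigr => k _; rewrite /d mulrA.
exists d; split=> [i|i iL|i iL].
- by rewrite mulf_neq0 ?invr_eq0 // /v mxE; exact: w0.
- have := dE i; rewrite iL (bigD1 i) //= BE iL eqxx mulr1 big1 ?addr0 // => k /negPf ki.
  by rewrite BE iL ki mulr0.
- rewrite -[RHS](_ : (i \in L)%:R = _); last by rewrite (negPf iL).
  by rewrite -dE; apply: eq_bigr => k _; rewrite BE (negPf iL).
Qed.

Lemma coef_fun_dconj (d : 'I_n -> R) (A : 'M[R]_n) o : (forall i, d i != 0) ->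
  (forall i, i \in L -> d i = 1) -> coef_fun M j o (dconj d A) = coef_fun M j o A.
Proof.
move=> d0 dL; rewrite /coef_fun; case: o => [[i|] k] /=; last by rewrite char_poly_dconj.
by case: ifP => // iI; rewrite cofactor_dconj // dL // inL.
Qed.

(** The polynomial relations between coefficients are the same for M and M~. *)
Lemma coef_relation m (o : 'I_m -> option 'I_n * nat) (G : {mpoly R[m]}) :
  pcomp (fun i => coef_mpoly R M j (o i)) G = 0 <->
  pcomp (fun i => coef_mpoly R M' j (o i)) G = 0.
Proof.
have ev (N : model n) (a : 'I_(nparam N) -> R) :
    (pcomp (fun i => coef_mpoly R N j (o i)) G).@[a] =
    G.@[fun i => coef_fun N j (o i) (cmx_at a)].
  by rewrite meval_pcomp; apply: meval_eq => i; rewrite meval_coef_mpoly.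
split=> G0; last first.
  apply: meval_all0 => a; have [a' aE] := cmx_at_extend a.
  by have := congr1 (meval a') G0; rewrite !ev meval0 aE.
suff /eqP : pcomp (fun i => coef_mpoly R M' j (o i)) G * Delta = 0.
  by rewrite mulf_eq0 (negPf Delta_neq0) orbF => /eqP.
apply: meval_all0 => a; rewrite mevalM.
have [->|/Delta_rescale[d [d0 dL dA]]] := eqVneq Delta.@[a] 0; first by rewrite mulr0.
have [b bE] := cmx_at_rescale d0 dL dA.
have := congr1 (meval b) G0; rewrite !ev meval0 bE => H.
rewrite -[X in X * _](_ : 0 = _) ?mul0r //; rewrite -H; apply: meval_eq => i.
by rewrite coef_fun_dconj.
Qed.

Lemma coef_algindep m (o : 'I_m -> option 'I_n * nat) :
  algindep (fun i => coef_mpoly R M j (o i)) <->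
  algindep (fun i => coef_mpoly R M' j (o i)).
Proof. by split=> H G /coef_relation; apply: H. Qed.

End Transfer.

(** * Identifiability and dimension *)

(** No member of an independent family is constant. *)
Lemma algindep_nonconst (R : comNzRingType) (m N : nat) (f : 'I_m -> {mpoly R[N]}) i c :
  algindep f -> f i != c%:MP.
Proof.
move=> fi; apply/eqP => fc; have /(congr1 (mcoeff U_(i))) : 'X_i - c%:MP = 0 :> {mpoly R[m]}.
  by apply: fi; rewrite rmorphB /= pcompX pcompC fc subrr.
rewrite mcoeffB mcoeffX mcoeffC eqxx mnm1_eq0 mulr0 subr0 mcoeff0.
by move/eqP; rewrite oner_eq0.
Qed.

Section Model.
Variables (R : realType) (n : nat) (M : model n) (j : 'I_n).

Lemma io_coefs_nth (k : 'I_(size (io_coefs R M j))) :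
  exists o, nth 0 (io_coefs R M j) k = coef_mpoly R M j o.
Proof. by have /io_coefsP[] := mem_nth 0 (ltn_ord k). Qed.

Lemma algindep_io_coefs m (o : 'I_m -> option 'I_n * nat) :
  algindep (fun i => coef_mpoly R M j (o i)) ->
  exists o' : 'I_m -> 'I_(size (io_coefs R M j)),
    algindep (fun i => nth 0 (io_coefs R M j) (o' i)).
Proof.
move=> fi; have mem i : coef_mpoly R M j (o i) \in io_coefs R M j.
  apply/io_coefsP; split; last by exists (o i).
    by have := algindep_nonconst i 0 fi; rewrite mpolyC0.
  by have := algindep_nonconst i 1 fi; rewrite mpolyC1.
exists (fun i => Ordinal (etrans (index_mem _ _) (mem i))) => G /= GE.
apply: fi; rewrite -[RHS]GE; apply: eq_pcomp => i.
by rewrite nth_index.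
Qed.

(** The coefficient map omits only the constant coefficients 0 and 1. *)
Lemma coefficient_map_inj_coefs (x y : 'rV[R]_(nparam M)) :
  @coefficient_map R n M j x = @coefficient_map R n M j y ->
  forall o, (coef_mpoly R M j o).@[x ord0] = (coef_mpoly R M j o).@[y ord0].
Proof.
move=> xy o; have [->|p0] := eqVneq (coef_mpoly R M j o) 0; first by rewrite !meval0.
have [->|p1] := eqVneq (coef_mpoly R M j o) 1; first by rewrite !meval1.
have /(nthP 0)[k kz <-] : coef_mpoly R M j o \in io_coefs R M j.
  by apply/io_coefsP; split=> //; exists o.
by have /rowP/(_ (Ordinal kz)) := xy; rewrite !mxE.
Qed.

End Model.

Theorem corollary5p11 (R : realType) (n : nat) (M : model n) (j : 'I_n)
    (hleak : leak M = (input M :|: output M)%SET)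
    (hconn : output_connectable M)
    (hout : output M = [set j]%SET) :
  locally_identifiable R M j <->
  has_dimension (range (@coefficient_map R n (leak_everywhere M) j))
    (#|edges M| + #|(input M :|: output M)%SET|)%N.
Proof.
rewrite -hleak -nparamE.
set M' := leak_everywhere M; set N := nparam M.
pose c' k := nth 0 (io_coefs R M' j) (k : 'I_(size (io_coefs R M' j))).
have /choice[o oE] : forall k, exists o, c' k = coef_mpoly R M' j o.
  by move=> k; exact: io_coefs_nth.
pose c k := coef_mpoly R M j (o k).
have relE (G : {mpoly R[size (io_coefs R M' j)]}) : pcomp c G = 0 <-> pcomp c' G = 0.
  rewrite (coef_relation hleak hconn hout o G).
  by rewrite (eq_pcomp (g := c')) // => k; rewrite oE.
have SE : range (@coefficient_map R n M' j) =
    range (fun a : 'rV[R]_(nparam M') => \row_i (c' i).@[a ord0]) by [].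
have indep_pull e (g : 'I_e -> {mpoly R[size (io_coefs R M' j)]}) :
    algindep (fun i => pcomp c' (g i)) -> algindep (fun i => pcomp c (g i)).
  move=> gi G; rewrite -pcomp_pcomp => /relE; rewrite pcomp_pcomp; exact: gi.
have N0 : (0 < N)%N.
  rewrite /N nparamE addn_gt0; apply/orP; right; apply/card_gt0P; exists j.
  by rewrite hleak hout !inE eqxx orbT.
split=> [[Z Z0 HZ]|[chainN _]].
- have [a nZa] : exists a, ~ Z a.
    apply: contrapT => H; apply: (@setT_not_measure_zero R N).
    apply: measure_zero_sub Z0 => // a _; apply: contrapT => nZ; apply: H.
    by exists a.
  have [U aU Uinj] := HZ a nZa.
  have [|o1 oi] := locally_injective_algindep
    (c := fun k : 'I_(size (io_coefs R M j)) => nth 0 (io_coefs R M j) k) aU.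
    move=> x y Ux Uy xy; apply: Uinj; rewrite ?inE //.
    by apply/rowP => k; rewrite !mxE.
  have /choice[o2 o2E] := fun k => @io_coefs_nth R n M j (o1 k).
  have [|o3 o3i] := @algindep_io_coefs R n M' j N o2.
    apply/(coef_algindep R hleak hconn hout o2) => G.
    rewrite (eq_pcomp (g := fun i => nth 0 (io_coefs R M j) (o1 i))); first exact: oi.
    by move=> i; rewrite o2E.
  (* A longer chain would give more than N independent polynomials in the
     coefficients of M~, hence of M, in N variables. *)
  split; first exact: (algindep_chain SE o3i).
  move=> e /(chain_algindep SE)[g /indep_pull].
  exact: algindep_leq.
(* The N independent polynomials in the coefficients of M form a locally injective
   map, hence so do the coefficients. *)
- have [g /indep_pull gi] := chain_algindep SE chainN.
  have [Z Z0 HZ] := algindep_locally_injective N0 gi.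
  exists Z => // a /HZ[U aU Uinj]; exists U => // x y /set_mem Ux /set_mem Uy xy.
  apply: Uinj => // i; rewrite !meval_pcomp; apply: meval_eq => k.
  exact: coefficient_map_inj_coefs.
Qed.
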